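(* Let $(A^+,\Delta)$ be a monoidal Garside structure such that $A^+$ has a $\nu$-structure. Denote by $S$ its atom set and by $A$ its associated Garside group. Let $A_X^+$ be a parabolic submonoid of $A^+$ such that $\mathrm{sh}(X)=\widetilde{\mathrm{sh}}(X)$. If the monoid $A^+_{\mathrm{sh}(X)}$ is a parabolic submonoid of $A^+$, whose Garside element is denoted by $\Delta_{\mathrm{sh}(X)}$, then: (i) The subgroup $A_{\mathrm{SH}(X)}$ is a standard parabolic subgroup(oid) of the groupoid $\mathcal{R}(A)$ with $A_X$ as unique object. In particular, $A_{\mathrm{SH}(X)}$ is a Garside group. The Garside element of $A^+_{\mathrm{SH}(X)}$ is $\Delta_{\mathrm{sh}(X)}$ and its atom set is $\mathrm{SH}(X)$. (ii) Write $\Delta_{\mathrm{sh}(X)}=\Delta_X\nabla_X$, where $\Delta_X$ is the Garside element of $A_X^+$. The subgroup $A_{\mathrm{SH}^\nu(X)}$ of $A$ is a standard parabolic subgroup of $A_{\mathrm{SH}(X)}$ with $\nabla_X$ as Garside element, and $$A_{\mathrm{SH}(X)}=QZ(A_X)\rtimes A_{\mathrm{SH}^\nu(X)}.$$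
   Context: Categories are small, composition is written left to right. For a category $\mathcal{C}$, $\mathcal{C}_{x\to\cdot}$ (resp. $\mathcal{C}_{\cdot\to x}$) is the set of morphisms with source (resp. target) $x$. An atom is a non-identity morphism that is not a product of two non-identity morphisms; $v$ left-divides $w$ if $w=vu$, right-divides $w$ if $w=uv$, is a factor of $w$ if $w=w_1vw_2$. A category is noetherian if every infinite sequence of morphisms, each a factor of the previous one, is eventually constant. A categorical Garside structure is a pair $(\mathcal{C},\Delta)$ such that $\mathcal{C}$ is a noetherian cancellative category with an automorphism $\Phi$; $\Delta$ is a natural transformation from $\mathrm{Id}$ to $\Phi$ (so $\Delta(x)\Phi(v)=v\Delta(y)$ for $v:x\to y$); $\mathcal{C}_{x\to\cdot}$ and $\mathcal{C}_{\cdot\to x}$ are lattices for left- and right-divisibility respectively; and for every atom $v\in\mathcal{C}_{x\to y}$ there is $\overline v\in\mathcal{C}_{y\to\Phi(x)}$ with $v\overline v=\Delta(x)$, $\overline v\,\Phi(v)=\Delta(y)$. $\mathcal{C}$ embeds in its groupoid of formal inverses $\mathcal{G}(\mathcal{C})$, called a Garside groupoid. With one object: monoidal Garside structure, Garside monoid, Garside group (group of fractions), Garside element $\Delta$. A subcategory $\mathcal{P}$ of $\mathcal{C}$ is parabolic if for every object $x$ of $\mathcal{P}$ the sets $\mathcal{P}_{x\to\cdot}$, $\mathcal{P}_{\cdot\to x}$ are sublattices of $\mathcal{C}_{x\to\cdot}$, $\mathcal{C}_{\cdot\to x}$, and there are an automorphism $\phi$ of $\mathcal{P}$ and morphisms $\delta(x)\in\mathcal{C}_{x\to\phi(x)}$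 with $\delta(x)\phi(v)=v\delta(y)$ for $v\in\mathcal{P}_{x\to y}$, such that for every object $x$ of $\mathcal{P}$ the set of left-divisors of $\delta(x)$ in $\mathcal{C}$ equals the set of left-divisors of $\Delta(x)$ lying in $\mathcal{P}_{x\to\cdot}$ and equals $\{\Delta(x)\wedge p:p\in\mathcal{P}_{x\to\cdot}\}$. Then $(\mathcal{P},\delta)$ is a categorical Garside structure, and $\mathcal{G}(\mathcal{P})\subseteq\mathcal{G}(\mathcal{C})$ is called a standard parabolic subgroupoid (subgroup, if $\mathcal{P}$ has one object); if $\mathcal{P}$ has one object, $\delta$ is its Garside element. For a Garside monoid $A^+$ with atom set $S$, a parabolic submonoid with atom set $X\subseteq S$ is denoted $A_X^+$, its Garside element $\Delta_X$, and $A_X$ is the subgroup of $A$ it generates. More generally, for any subset $Y$ of $A^+$, $A_Y^+$ and $A_Y$ denote the submonoid of $A^+$ and the subgroup of $A$ generated by $Y$. The positive ribbon category $\mathcal{R}^+(A^+)$ has as objects the parabolic submonoids; morphisms $A_X^+\to A_Y^+$ are the $g\in A^+$ with $g^{-1}A_X^+g=A_Y^+$. The ribbon groupoid $\mathcal{R}(A)$ has as objects the standard parabolic subgroups $A_X$; morphisms $A_X\to A_Y$ are the $g\in A$ with $g^{-1}A_X^+g=A_Y^+$. When $A^+$ has a $\nu$-structure, $\mathcal{R}^+(A^+)$ with the natural transformation equal to $\Delta$ at every object is a categorical Garside structure with Garside groupoid $\mathcal{R}(A)$. The quasi-centralizer is $QZ(A_X)=\{g\in A_X: gA_X^+=A_X^+g\}$.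 Let $\vee$ (resp. $\tilde\vee$) be the lcm in $A^+$ for left- (resp. right-) divisibility. $A^+$ has a $\nu$-structure if for each parabolic submonoid $A_X^+$ there are maps $\nu_X:S\to\mathcal{R}^+(A^+)_{A_X^+\to\cdot}$ and $\tilde\nu_X:S\to\mathcal{R}^+(A^+)_{\cdot\to A_X^+}$ whose values are atoms of $\mathcal{R}^+(A^+)$ and such that: if $s\in S$ left-divides $g\in\mathcal{R}^+(A^+)_{A_X^+\to\cdot}$ then $\nu_X(s)$ left-divides $g$; if $s$ right-divides $g\in\mathcal{R}^+(A^+)_{\cdot\to A_X^+}$ then $\tilde\nu_X(s)$ right-divides $g$; for all $s,t\in S$, $\nu_X(s)\vee\nu_X(t)\in\mathcal{R}^+(A^+)_{A_X^+\to\cdot}$ and $\tilde\nu_X(s)\tilde\vee\tilde\nu_X(t)\in\mathcal{R}^+(A^+)_{\cdot\to A_X^+}$. Shakers: $\mathrm{SH}(X)=\{\nu_X(s)\mid s\in S,\ \nu_X(s)\in\mathcal{R}(A)_{A_X\to A_X}\}$, which equals $\{\tilde\nu_X(s)\mid s\in S,\ \tilde\nu_X(s)\in\mathcal{R}(A)_{A_X\to A_X}\}$; $\mathrm{SH}^\nu(X)=\{g\in\mathrm{SH}(X): g\notin A_X^+\}$; $\mathrm{sh}(X)=\nu_X^{-1}(\mathrm{SH}(X))\subseteq S$ and $\widetilde{\mathrm{sh}}(X)=\tilde\nu_X^{-1}(\mathrm{SH}(X))\subseteq S$. The submonoid $A^+_{\mathrm{SH}(X)}$ is regarded as a subcategory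 of $\mathcal{R}^+(A^+)$ with single object $A_X^+$, and $A_{\mathrm{SH}(X)}$ as a subgroupoid of $\mathcal{R}(A)$ with single object $A_X$. In (ii), parabolicity in $A_{\mathrm{SH}(X)}$ is with respect to the monoidal Garside structure $(A^+_{\mathrm{SH}(X)},\Delta_{\mathrm{sh}(X)})$. *)

(* Defs.v *)
From mathcomp Require Import all_boot.
From mathcomp Require Import boolp classical_sets.

Set Implicit Arguments.
Unset Strict Implicit.
Unset Printing Implicit Defensive.

Local Open Scope classical_set_scope.
Local Open Scope group_scope.

Lemma sval_eq (T : Type) (P : T -> Prop) (u v : {x : T | P x}) :
  sval u = sval v -> u = v.
Proof.
case: u v => [x Px] [y Py] /= xy; subst y.
by rewrite (Prop_irrelevance Px Py).
Qed.

(* Composition is written from left to right. *)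
Record category := Category {
  ob : Type;
  hom : ob -> ob -> Type;
  idm : forall x, hom x x;
  comp : forall x y z, hom x y -> hom y z -> hom x z;
  comp1m : forall x y (f : hom x y), comp (idm x) f = f;
  compm1 : forall x y (f : hom x y), comp f (idm y) = f;
  compA : forall x y z t (f : hom x y) (g : hom y z) (h : hom z t),
    comp f (comp g h) = comp (comp f g) h
}.
Arguments hom {c} _ _.
Arguments idm {c} x.
Arguments comp {c x y z} _ _.

Notation "f ∘> g" := (comp f g) (at level 40, left associativity).

Record functor (C D : category) := Functor {
  fob : ob C -> ob D;
  fhom : forall x y, hom x y -> hom (fob x) (fob y);
  fhom1 : forall x, fhom (idm x) = idm (fob x);
  fhomM : forall x y z (f : hom x y) (g : hom y z),
    fhom (f ∘> g) = fhom f ∘> fhom g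
}.
Arguments fob {C D} _ _.
Arguments fhom {C D} _ {x y} _.

Definition functor_comp (C D E : category) (F : functor C D) (G : functor D E)
  : functor C E.
Proof.
refine (@Functor C E (fun x => fob G (fob F x))
                     (fun _ _ f => fhom G (fhom F f)) _ _).
- by move=> x; rewrite !fhom1.
- by move=> x y z f g; rewrite !fhomM.
Defined.

Definition is_automorphism (C : category) (F : functor C C) : Prop :=
  bijective (fob F) /\ forall x y : ob C, bijective (@fhom C C F x y).

Definition is_groupoid (C : category) : Prop :=
  forall (x y : ob C) (f : hom x y),
    exists g : hom y x, f ∘> g = idm x /\ g ∘> f = idm y.

(* G, together with j : C -> G, is the groupoid of formal inverses of C:
   it is the universal groupoid under C. *)
Definition is_formal_inverses (C G : category) (j : functor C G) : Prop :=
  is_groupoid G /\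
  forall (K : category) (F : functor C K), is_groupoid K ->
    exists! F' : functor G K, functor_comp j F' = F.

Section Divisibility.
Variable C : category.

Inductive is_id : forall x y : ob C, hom x y -> Prop :=
  IsId x : is_id (idm x).

Definition is_atom (x y : ob C) (v : hom x y) : Prop :=
  ~ is_id v /\
  forall z (f : hom x z) (g : hom z y), f ∘> g = v -> is_id f \/ is_id g.

Record arrow := Arrow { src : ob C; tgt : ob C; mor : hom src tgt }.

Definition factor (v w : arrow) : Prop :=
  exists (w1 : hom (src w) (src v)) (w2 : hom (tgt v) (tgt w)),
    mor w = w1 ∘> mor v ∘> w2.

Definition noetherian : Prop :=
  forall f : nat -> arrow, (forall n, factor (f n.+1) (f n)) ->
    exists N, forall n, (N <= n)%N -> f n = f N.

Definition cancellative : Prop :=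
  (forall (x y z : ob C) (f : hom x y) (g h : hom y z),
     f ∘> g = f ∘> h -> g = h) /\
  (forall (x y z : ob C) (f g : hom x y) (h : hom y z),
     f ∘> h = g ∘> h -> f = g).

(* The sets of all morphisms with a given source, resp. target. *)
Definition outm (x : ob C) : Type := {y : ob C & hom x y}.
Definition inm (x : ob C) : Type := {y : ob C & hom y x}.

Definition outm_of (x y : ob C) (f : hom x y) : outm x := existT _ y f.

Definition left_div (x : ob C) (v w : outm x) : Prop :=
  exists u : hom (projT1 v) (projT1 w), projT2 w = projT2 v ∘> u.

Definition right_div (x : ob C) (v w : inm x) : Prop :=
  exists u : hom (projT1 w) (projT1 v), projT2 w = u ∘> projT2 v.

End Divisibility.

Section Lattice.
Variables (T : Type) (le : T -> T -> Prop).

Definition is_join (a b m : T) : Prop :=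
  le a m /\ le b m /\ forall c, le a c -> le b c -> le m c.

Definition is_meet (a b m : T) : Prop :=
  le m a /\ le m b /\ forall c, le c a -> le c b -> le c m.

Definition is_lattice : Prop :=
  [/\ forall a, le a a,
      forall a b, le a b -> le b a -> a = b,
      forall a b c, le a b -> le b c -> le a c,
      forall a b, exists m, is_join a b m &
      forall a b, exists m, is_meet a b m].

Definition is_sublattice (L : set T) : Prop :=
  forall a b, L a -> L b ->
    (exists2 m, is_join a b m & L m) /\ (exists2 m, is_meet a b m & L m).

End Lattice.

Record garside_data (C : category) := GarsideData {
  gPhi : functor C C;
  gDelta : forall x : ob C, hom x (fob gPhi x)
}.
Arguments gDelta {C} _ x.

Definition is_garside (C : category) (D : garside_data C) : Prop :=
  [/\ noetherian C /\ cancellative C,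
      is_automorphism (gPhi D),
      forall (x y : ob C) (v : hom x y),
        gDelta D x ∘> fhom (gPhi D) v = v ∘> gDelta D y,
      forall x : ob C,
        is_lattice (@left_div C x) /\ is_lattice (@right_div C x) &
      forall (x y : ob C) (v : hom x y), is_atom v ->
        exists v' : hom y (fob (gPhi D) x),
          v ∘> v' = gDelta D x /\ v' ∘> fhom (gPhi D) v = gDelta D y].

Record subcategory (C : category) := Subcategory {
  sob : ob C -> Prop;
  shom : forall x y : ob C, hom x y -> Prop;
  shom_ob : forall (x y : ob C) (f : hom x y), shom f -> sob x /\ sob y;
  shom1 : forall x : ob C, sob x -> shom (idm x);
  shomM : forall (x y z : ob C) (f : hom x y) (g : hom y z),
    shom f -> shom g -> shom (f ∘> g)
}.
Arguments sob {C} _ _.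
Arguments shom {C} _ {x y} _.

Definition sub_cat (C : category) (P : subcategory C) : category.
Proof.
refine (@Category {x : ob C | sob P x}
  (fun x y => {f : hom (sval x) (sval y) | shom P f})
  (fun x => exist _ (idm (sval x)) (shom1 (proj2_sig x)))
  (fun x y z f g =>
     exist _ (sval f ∘> sval g) (shomM (proj2_sig f) (proj2_sig g))) _ _ _).
- by move=> x y f; apply: sval_eq; rewrite /= comp1m.
- by move=> x y f; apply: sval_eq; rewrite /= compm1.
- by move=> x y z t f g h; apply: sval_eq; rewrite /= compA.
Defined.

Definition sub_incl (C : category) (P : subcategory C) :
  functor (sub_cat P) C :=
  @Functor (sub_cat P) C (fun x => sval x) (fun _ _ f => sval f)
    (fun _ => erefl) (fun _ _ _ _ _ => erefl).

Definition sub_out (C : category) (P : subcategory C) (x : ob C) :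
  set (outm x) := [set f : outm x | shom P (projT2 f)].

Definition sub_in (C : category) (P : subcategory C) (x : ob C) :
  set (inm x) := [set f : inm x | @shom C P (projT1 f) x (projT2 f)].

Arguments sub_out {C} P x.
Arguments sub_in {C} P x.

Record parabolic_data (C : category) (P : subcategory C) := ParabolicData {
  pphi : functor (sub_cat P) (sub_cat P);
  pdelta : forall x : ob (sub_cat P), hom (sval x) (sval (fob pphi x))
}.
Arguments pdelta {C P} _ x.

Definition is_parabolic (C : category) (D : garside_data C)
    (P : subcategory C) (Q : parabolic_data P) : Prop :=
  [/\ forall x, sob P x ->
        is_sublattice (@left_div C x) (sub_out P x) /\
        is_sublattice (@right_div C x) (sub_in P x),
      is_automorphism (pphi Q),
      forall (x y : ob (sub_cat P)) (v : hom x y),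
        pdelta Q x ∘> sval (fhom (pphi Q) v) = sval v ∘> pdelta Q y &
      forall x : ob (sub_cat P),
        let delta := outm_of (pdelta Q x) in
        let Delta := outm_of (gDelta D (sval x)) in
        [set d | left_div d delta] =
          [set d | left_div d Delta] `&` sub_out P (sval x) /\
        [set d | left_div d delta] =
          [set d | exists2 p, sub_out P (sval x) p
                            & is_meet (@left_div C (sval x)) Delta p d]].

(* For j : C -> G exhibiting G as the Garside groupoid of C, the subgroupoid H
   of G is G(P), for the parabolic subcategory P of C with data Q. *)
Definition standard_parabolic (C : category) (D : garside_data C)
    (G : category) (j : functor C G)
    (P : subcategory C) (Q : parabolic_data P) (H : subcategory G) : Prop :=
  is_parabolic D Q /\
  exists k : functor (sub_cat P) (sub_cat H),
    functor_comp k (sub_incl H) = functor_comp (sub_incl P) j /\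
    is_formal_inverses k.

(* All monoids below are submonoids of an ambient group: a Garside monoid
   embeds in its group of formal inverses. *)
Section Submonoids.
Variable A : groupType.

Definition is_submonoid (U : set A) : Prop :=
  U 1 /\ forall x y, U x -> U y -> U (x * y).

Definition is_subgroup (U : set A) : Prop :=
  is_submonoid U /\ forall x, U x -> U x^-1.

Record submonoid :=
  Submonoid { subm_set :> set A; submP : is_submonoid subm_set }.

Lemma submonoid_eq (U V : submonoid) : U = V :> set A -> U = V.
Proof.
case: U V => [U HU] [V HV] /= UV; subst V.
by rewrite (Prop_irrelevance HU HV).
Qed.

Lemma full_subproof : is_submonoid setT. Proof. by []. Qed.
Definition full : submonoid := Submonoid full_subproof.

Lemma sub_full (U : submonoid) : U `<=` full. Proof. by []. Qed.

Lemma gen_mon_subproof (Y : set A) : is_submonoid (smallest is_submonoid Y).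
Proof.
split=> [V [[V1 _] _] //|x y Vx Vy V VY].
by apply: VY.1.2; [apply: Vx | apply: Vy].
Qed.
Definition gen_mon (Y : set A) : submonoid := Submonoid (gen_mon_subproof Y).

Lemma gen_grp_subproof (Y : set A) : is_submonoid (smallest is_subgroup Y).
Proof.
split=> [V [[[V1 _] _] _] //|x y Vx Vy V VY].
by apply: VY.1.1.2; [apply: Vx | apply: Vy].
Qed.
Definition gen_grp (Y : set A) : submonoid := Submonoid (gen_grp_subproof Y).

Lemma gen_mon_grp (Y : set A) : gen_mon Y `<=` gen_grp Y.
Proof. by move=> x Yx V [[Vm _] YV]; apply: Yx. Qed.

(* The one-object category of a submonoid of A (a groupoid if it is a
   subgroup). *)
Definition mon_cat (U : submonoid) : category.
Proof.
refine (@Category unit (fun _ _ => {g : A | subm_set U g})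
  (fun _ => exist _ 1 (submP U).1)
  (fun _ _ _ f g =>
     exist _ (sval f * sval g) ((submP U).2 _ _ (proj2_sig f) (proj2_sig g)))
  _ _ _).
- by move=> x y f; apply: sval_eq; rewrite /= mul1g.
- by move=> x y f; apply: sval_eq; rewrite /= mulg1.
- by move=> x y z t f g h; apply: sval_eq; rewrite /= mulgA.
Defined.

Definition mon_incl (U V : submonoid) (UV : U `<=` V) :
  functor (mon_cat U) (mon_cat V).
Proof.
refine (@Functor (mon_cat U) (mon_cat V) id
  (fun _ _ f => exist _ (sval f) (UV _ (proj2_sig f))) _ _).
- by move=> x; apply: sval_eq.
- by move=> x y z f g; apply: sval_eq.
Defined.

Definition atoms (U : submonoid) : set A :=
  [set s | exists f : @hom (mon_cat U) tt tt, is_atom f /\ sval f = s].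

(* The subcategory of [mon_cat U] given by a submonoid V of U. *)
Definition mon_sub (U V : submonoid) : subcategory (mon_cat U).
Proof.
refine (@Subcategory (mon_cat U) (fun _ => True) (fun _ _ f => subm_set V (sval f))
  _ _ _).
- by [].
- by move=> x _; apply: (submP V).1.
- by move=> x y z f g; apply: (submP V).2.
Defined.

(* V is a parabolic submonoid of U, with Garside element d. *)
Definition parabolic_submonoid (U : submonoid) (D : garside_data (mon_cat U))
    (V : submonoid) (d : A) : Prop :=
  V `<=` U /\
  exists2 Q : parabolic_data (mon_sub U V),
    is_parabolic D Q & forall x, sval (pdelta Q x) = d.

Definition conj_set (X : set A) (g : A) : set A := [set x ^ g | x in X].

Lemma conj_set1 (X : set A) : conj_set X 1 = X.
Proof.
apply/seteqP; split=> [_ [x Xx <-]|x Xx]; first by rewrite conjg1.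
by exists x; rewrite ?conjg1.
Qed.

Lemma conj_setM (X Y Z : set A) (f g : A) :
  conj_set X f = Y -> conj_set Y g = Z -> conj_set X (f * g) = Z.
Proof.
move=> <- <-; apply/seteqP; split=> [_ [x Xx <-]|_ [_ [x Xx <-] <-]].
  by exists (x ^ f); [exists x | rewrite conjgM].
by exists x => //; rewrite conjgM.
Qed.

Definition quasi_centralizer (X : submonoid) : set A :=
  [set g | subm_set (gen_grp X) g /\ [set g * x | x in X] = [set x * g | x in X]].

Definition is_semidirect_product (G N K : set A) : Prop :=
  [/\ [/\ is_subgroup G, is_subgroup N & is_subgroup K],
      N `<=` G /\ K `<=` G,
      forall n g, N n -> G g -> N (n ^ g),
      N `&` K = [set 1] &
      G = [set n * k | n in N & k in K]].

End Submonoids.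

Section Ribbons.
Variables (A : groupType) (Ap : submonoid A) (D : garside_data (mon_cat Ap)).

(* The parabolic submonoids A_X^+.  These also index the objects A_X of the
   ribbon groupoid, as A_X^+ is the intersection of A_X and A^+. *)
Record ribbon_ob := RibbonOb {
  rsubm :> submonoid A;
  rparab : exists d, parabolic_submonoid D rsubm d
}.

Lemma ribbon_ob_eq (X Y : ribbon_ob) : X = Y :> set A -> X = Y.
Proof.
case: X Y => [X HX] [Y HY] /= XY.
have {}XY := submonoid_eq XY; subst Y.
by rewrite (Prop_irrelevance HX HY).
Qed.

(* The ribbons lying in U: this is R^+(A^+) for U = A^+ and R(A) for U = A. *)
Definition ribbon_cat (U : submonoid A) : category.
Proof.
refine (@Category ribbon_ob
  (fun X Y => {g : A | subm_set U g /\ conj_set X g = Y})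
  (fun X => exist _ 1 (conj (submP U).1 (conj_set1 X)))
  (fun X Y Z f g => exist _ (sval f * sval g)
     (conj ((submP U).2 _ _ (proj2_sig f).1 (proj2_sig g).1)
           (conj_setM (proj2_sig f).2 (proj2_sig g).2))) _ _ _).
- by move=> x y f; apply: sval_eq; rewrite /= mul1g.
- by move=> x y f; apply: sval_eq; rewrite /= mulg1.
- by move=> x y z t f g h; apply: sval_eq; rewrite /= mulgA.
Defined.

Definition ribbon_incl (U V : submonoid A) (UV : U `<=` V) :
  functor (ribbon_cat U) (ribbon_cat V).
Proof.
refine (@Functor (ribbon_cat U) (ribbon_cat V) id
  (fun X Y f => exist _ (sval f)
     (conj (UV _ (proj2_sig f).1) (proj2_sig f).2)) _ _).
- by move=> x; apply: sval_eq.
- by move=> x y z f g; apply: sval_eq.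
Defined.

(* A submonoid V of A as a subcategory with single object X. *)
Definition loop_sub (U : submonoid A) (X : ribbon_ob) (V : submonoid A) :
  subcategory (ribbon_cat U).
Proof.
refine (@Subcategory (ribbon_cat U) (fun Y => Y = X)
  (fun Y Z f => [/\ Y = X, Z = X & subm_set V (sval f)]) _ _ _).
- by move=> Y Z f [YX ZX _].
- by move=> Y YX; split=> //; apply: (submP V).1.
- move=> Y Z T f g [YX _ Vf] [_ TX Vg]; split=> //.
  exact: (submP V).2 Vf Vg.
Defined.

End Ribbons.

(* Conjugation by Delta permutes the parabolic submonoids of A^+. *)
Section ConjDelta.
Variables (A : groupType) (Ap : submonoid A) (D : garside_data (mon_cat Ap)).
Hypothesis HD : is_garside D.

Local Notation Delta := (sval (gDelta D tt)).

Lemma Delta_mem : subm_set Ap Delta.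
Proof. exact: proj2_sig. Qed.

Lemma PhiE (v : @hom (mon_cat Ap) tt tt) :
  sval (fhom (gPhi D) v) = sval v ^ Delta.
Proof.
case: HD => _ _ /(_ tt tt v) /(congr1 sval) /= H _ _.
by rewrite conjgE -H mulKg.
Qed.

Lemma conj_Delta_mem g : subm_set Ap g -> subm_set Ap (g ^ Delta).
Proof.
move=> Ug; pose v : @hom (mon_cat Ap) tt tt := exist _ g Ug.
by rewrite -[g]/(sval v) -PhiE; apply: proj2_sig.
Qed.

Lemma conj_DeltaV_mem g : subm_set Ap g -> subm_set Ap (g ^ Delta^-1).
Proof.
move=> Ug; case: HD => _ [_ /(_ tt tt) [h _ hK]] _ _ _.
pose v : hom (fob (gPhi D) tt) (fob (gPhi D) tt) := exist _ g Ug.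
have /(congr1 sval) := hK v; rewrite PhiE /= => <-.
by rewrite conjgK; apply: proj2_sig.
Qed.

Let cj (b : A) (Hb : forall g, subm_set Ap g -> subm_set Ap (g ^ b))
  (f : {g | subm_set Ap g}) : {g | subm_set Ap g} :=
  exist _ (sval f ^ b) (Hb _ (proj2_sig f)).

Section Order.
Variables (T : Type) (le : T -> T -> Prop) (c c' : T -> T).
Hypotheses (cK : cancel c c') (c'K : cancel c' c).
Hypothesis le_c : forall a b, le (c a) (c b) <-> le a b.

Lemma is_join_c a b m : is_join le (c a) (c b) (c m) <-> is_join le a b m.
Proof.
split=> -[].
  move=> /le_c am [/le_c bm H]; split=> //; split=> // e.
  by move=> /le_c ae /le_c be; apply/le_c; exact: H.
move=> am [bm H]; split; first exact/le_c; split; first exact/le_c.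
move=> e; rewrite -(c'K e) => /le_c ae /le_c be; apply/le_c; exact: H.
Qed.

Lemma is_meet_c a b m : is_meet le (c a) (c b) (c m) <-> is_meet le a b m.
Proof.
split=> -[].
  move=> /le_c am [/le_c bm H]; split=> //; split=> // e.
  by move=> /le_c ae /le_c be; apply/le_c; exact: H.
move=> am [bm H]; split; first exact/le_c; split; first exact/le_c.
move=> e; rewrite -(c'K e) => /le_c ae /le_c be; apply/le_c; exact: H.
Qed.

Lemma is_sublattice_c (L L' : set T) : (forall a, L' (c a) <-> L a) ->
  is_sublattice le L -> is_sublattice le L'.
Proof.
move=> LL H a b; rewrite -(c'K a) -(c'K b) => /LL La /LL Lb.
have [[m Hm Lm] [n Hn Ln]] := H _ _ La Lb.
by split; [exists (c m); [exact/is_join_c | exact/LL]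
          |exists (c n); [exact/is_meet_c | exact/LL]].
Qed.

End Order.

Let co b Hb (f : @outm (mon_cat Ap) tt) : @outm (mon_cat Ap) tt :=
  existT _ tt (@cj b Hb (projT2 f)).
Let ci b Hb (f : @inm (mon_cat Ap) tt) : @inm (mon_cat Ap) tt :=
  existT _ tt (@cj b Hb (projT2 f)).

Let c := co conj_Delta_mem.
Let c' := co conj_DeltaV_mem.
Let d := ci conj_Delta_mem.
Let d' := ci conj_DeltaV_mem.

Let cK : cancel c c'.
Proof.
by case=> -[] f; congr existT; apply: sval_eq; rewrite /= conjgK.
Qed.
Let c'K : cancel c' c.
Proof.
by case=> -[] f; congr existT; apply: sval_eq; rewrite /= conjgKV.
Qed.
Let dK : cancel d d'.
Proof.
by case=> -[] f; congr existT; apply: sval_eq; rewrite /= conjgK.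
Qed.
Let d'K : cancel d' d.
Proof.
by case=> -[] f; congr existT; apply: sval_eq; rewrite /= conjgKV.
Qed.

Let le_c a b : left_div (c a) (c b) <-> left_div a b.
Proof.
split=> -[u /(congr1 sval) /= H].
  exists (cj conj_DeltaV_mem u); apply: sval_eq => /=.
  by apply: (conjg_inj Delta); rewrite H conjMg conjgKV.
by exists (cj conj_Delta_mem u); apply: sval_eq; rewrite /= H conjMg.
Qed.

Let le_d a b : right_div (d a) (d b) <-> right_div a b.
Proof.
split=> -[u /(congr1 sval) /= H].
  exists (cj conj_DeltaV_mem u); apply: sval_eq => /=.
  by apply: (conjg_inj Delta); rewrite H conjMg conjgKV.
by exists (cj conj_Delta_mem u); apply: sval_eq; rewrite /= H conjMg.
Qed.

Lemma conj_subm_subproof (V : submonoid A) b : is_submonoid (conj_set V b).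
Proof.
split; first by exists 1; [exact: (submP V).1 | rewrite conj1g].
move=> _ _ [x Vx <-] [y Vy <-].
by exists (x * y); [exact: (submP V).2 | rewrite conjMg].
Qed.
Definition conj_subm (V : submonoid A) b : submonoid A :=
  Submonoid (conj_subm_subproof V b).

Let conj_subm_mem (V : submonoid A) b g :
  subm_set (conj_subm V b) (g ^ b) <-> subm_set V g.
Proof. by split=> [[x Vx /conjg_inj <-] //|Vg]; exists g. Qed.

Lemma parabolic_conj (V : submonoid A) (e : A) :
  parabolic_submonoid D V e ->
  parabolic_submonoid D (conj_subm V Delta) (e ^ Delta).
Proof.
move=> [VU [Q [Hlat [_ Hbij] Hnat Hdiv] Qe]].
pose tt' : ob (sub_cat (mon_sub Ap V)) := exist _ tt I.
have Ue : subm_set Ap e.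
  by rewrite -(Qe tt'); apply: proj2_sig.
have phiE (x y : ob (sub_cat (mon_sub Ap V))) (v : hom x y) :
    sval (sval (fhom (pphi Q) v)) = sval (sval v) ^ e.
  have /(congr1 sval) /= := Hnat x y v; rewrite !Qe => H.
  by rewrite conjgE -H mulKg.
have Ve g : subm_set V g -> subm_set V (g ^ e).
  move=> Vg; pose v : @hom (sub_cat (mon_sub Ap V)) tt' tt' :=
    exist _ (exist _ g (VU _ Vg)) Vg.
  by rewrite -[g]/(sval (sval v)) -phiE; apply: (proj2_sig (fhom (pphi Q) v)).
have VeV g : subm_set V g -> subm_set V (g ^ e^-1).
  move=> Vg; have [h _ hK] := Hbij tt' tt'.
  pose v : @hom (sub_cat (mon_sub Ap V)) (fob (pphi Q) tt') (fob (pphi Q) tt')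
    := exist _ (exist _ g (VU _ Vg)) Vg.
  have /(congr1 (fun z => sval (sval z))) := hK v; rewrite phiE /= => <-.
  by rewrite conjgK; apply: (proj2_sig (h v)).
pose V' := conj_subm V Delta; pose e' := e ^ Delta.
have V'U : V' `<=` Ap by move=> _ [x Vx <-]; apply/conj_Delta_mem/VU.
have V'e g : subm_set V' g -> subm_set V' (g ^ e').
  by move=> [x /Ve Vx <-]; rewrite -conjJg; apply/conj_subm_mem.
have V'eV g : subm_set V' g -> subm_set V' (g ^ e'^-1).
  by move=> [x /VeV Vx <-]; rewrite -conjVg -conjJg; apply/conj_subm_mem.
pose act b (H : forall g, subm_set V' g -> subm_set V' (g ^ b))
    (f : {f : {g | subm_set Ap g} | subm_set V' (sval f)}) :
    {f : {g | subm_set Ap g} | subm_set V' (sval f)} :=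
  exist _ (exist _ (sval (sval f) ^ b) (V'U _ (H _ (proj2_sig f))))
    (H _ (proj2_sig f)).
have act1 : forall x : ob (sub_cat (mon_sub Ap V')),
    act e' V'e (idm x) = idm x.
  by move=> x; do 2!apply: sval_eq; rewrite /= conj1g.
have actM : forall (x y z : ob (sub_cat (mon_sub Ap V')))
      (f : hom x y) (g : hom y z),
    act e' V'e (f ∘> g) = (act e' V'e f : hom x y) ∘> (act e' V'e g : hom y z).
  by move=> x y z f g; do 2!apply: sval_eq; rewrite /= conjMg.
pose F : functor (sub_cat (mon_sub Ap V')) (sub_cat (mon_sub Ap V')) :=
  @Functor (sub_cat (mon_sub Ap V')) (sub_cat (mon_sub Ap V')) id
    (fun _ _ f => act e' V'e f) act1 actM.
pose Q' : parabolic_data (mon_sub Ap V') :=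
  @ParabolicData _ _ F (fun x => exist _ e' (conj_Delta_mem Ue)).
split=> //; exists Q' => //; split.
- move=> [] _; have [Hl Hr] := Hlat tt I; split.
    apply: (is_sublattice_c c'K le_c _ Hl) => a; exact: conj_subm_mem.
  apply: (is_sublattice_c d'K le_d _ Hr) => a; exact: conj_subm_mem.
- split; first by exists id.
  move=> x y; exists (act e'^-1 V'eV) => f; do 2!apply: sval_eq.
    by rewrite /= conjgK.
  by rewrite /= conjgKV.
- by move=> x y v; apply: sval_eq; rewrite /= -conjgC.
- move=> [[] []] delta Dl; have [] := Hdiv tt'.
  set delta0 := outm_of _; set Dl0 := outm_of _ => H1 H2.
  have {}H1 (f : @outm (mon_cat Ap) tt) : left_div f delta0 <-> left_div f Dl0 /\ @sub_out (mon_cat Ap) (mon_sub Ap V) tt f.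
    by rewrite -[left_div f delta0]/([set f | left_div f delta0] f) H1.
  have {}H2 (f : @outm (mon_cat Ap) tt) : left_div f delta0 <->
      exists2 p, @sub_out (mon_cat Ap) (mon_sub Ap V) tt p & is_meet (@left_div (mon_cat Ap) tt) Dl0 p f.
    by rewrite -[left_div f delta0]/([set f | left_div f delta0] f) H2.
  have outE (f g : @outm (mon_cat Ap) tt) :
      sval (projT2 f) = sval (projT2 g) -> f = g.
    by case: f g => [[] f] [[] g] /= /sval_eq ->.
  have deltaE : delta = c delta0 by apply: outE; rewrite /= Qe.
  have DlE : Dl = c Dl0 by apply: outE; rewrite /= conjgE mulKg.
  have outc (f : @outm (mon_cat Ap) tt) : @sub_out (mon_cat Ap) (mon_sub Ap V') tt (c f) <-> @sub_out (mon_cat Ap) (mon_sub Ap V) tt f.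
    exact: conj_subm_mem.
  split; apply/seteqP; split=> f /=; rewrite -(c'K f) deltaE DlE !le_c.
  + by move=> /H1[? /outc].
  + by move=> [? /outc ?]; apply/H1.
  + move=> /H2[p Vp Hp]; exists (c p); first exact/outc.
    exact/(is_meet_c c'K le_c).
  + move=> [p]; rewrite -(c'K p) => /outc Vp /(is_meet_c c'K le_c) Hp.
    by apply/H2; exists (c' p).
Qed.

End ConjDelta.

Section RibbonGarside.
Variables (A : groupType) (Ap : submonoid A) (D : garside_data (mon_cat Ap)).
Hypothesis HD : is_garside D.

Local Notation Delta := (sval (gDelta D tt)).

Lemma ribbon_conj_subproof (X : ribbon_ob D) :
  exists d, parabolic_submonoid D (conj_subm X Delta) d.
Proof.
by have [d Xd] := rparab X; exists (d ^ Delta); apply: parabolic_conj.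
Qed.
Definition ribbon_conj (X : ribbon_ob D) : ribbon_ob D :=
  RibbonOb (ribbon_conj_subproof X).

Lemma ribbon_conj_hom (X Y : ribbon_ob D) (g : A) :
  subm_set Ap g /\ conj_set X g = Y ->
  subm_set Ap (g ^ Delta) /\
  conj_set (ribbon_conj X) (g ^ Delta) = ribbon_conj Y.
Proof.
move=> [Ug XY]; split; first exact: conj_Delta_mem.
apply/seteqP; split=> [_ [_ [x Xx <-] <-]|_ [y Yy <-]].
  by rewrite -conjJg; exists (x ^ g) => //; rewrite -XY; exists x.
move: Yy; rewrite -XY => -[x Xx <-].
by exists (x ^ Delta); [exists x | rewrite -conjJg].
Qed.

(* The Garside structure of R^+(A^+): the natural transformation is Delta at
   every object, which forces the automorphism to be conjugation by Delta. *)
Definition ribbon_Phi : functor (ribbon_cat D Ap) (ribbon_cat D Ap).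
Proof.
refine (@Functor (ribbon_cat D Ap) (ribbon_cat D Ap) ribbon_conj
  (fun _ _ f => exist _ (sval f ^ Delta) (ribbon_conj_hom (proj2_sig f))) _ _).
- by move=> X; apply: sval_eq; rewrite /= conj1g.
- by move=> X Y Z f g; apply: sval_eq; rewrite /= conjMg.
Defined.

Definition ribbon_garside : garside_data (ribbon_cat D Ap) :=
  @GarsideData (ribbon_cat D Ap) ribbon_Phi
    (fun X => exist _ Delta (conj (Delta_mem D) erefl)).

End RibbonGarside.

Section Nu.
Variables (A : groupType) (Ap : submonoid A) (D : garside_data (mon_cat Ap)).

Definition ribbon_forget : functor (ribbon_cat D Ap) (mon_cat Ap).
Proof.
refine (@Functor (ribbon_cat D Ap) (mon_cat Ap) (fun _ => tt)
  (fun _ _ f => exist _ (sval f) (proj2_sig f).1) _ _).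
- by move=> X; apply: sval_eq.
- by move=> X Y Z f g; apply: sval_eq.
Defined.

Definition fout (X : ribbon_ob D) (g : @outm (ribbon_cat D Ap) X) :
  @outm (mon_cat Ap) tt := existT _ tt (fhom ribbon_forget (projT2 g)).
Definition fin (X : ribbon_ob D) (g : @inm (ribbon_cat D Ap) X) :
  @inm (mon_cat Ap) tt := existT _ tt (fhom ribbon_forget (projT2 g)).

(* The atom set S of A^+. *)
Definition atom_type : Type :=
  {s : @hom (mon_cat Ap) tt tt | is_atom s}.
Definition aout (s : atom_type) : @outm (mon_cat Ap) tt :=
  existT _ tt (sval s).
Definition ain (s : atom_type) : @inm (mon_cat Ap) tt :=
  existT _ tt (sval s).

Record nu_structure := NuStructure {
  nu : forall X : ribbon_ob D, atom_type -> @outm (ribbon_cat D Ap) X;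
  nut : forall X : ribbon_ob D, atom_type -> @inm (ribbon_cat D Ap) X;
  nu_atom : forall X s, is_atom (projT2 (nu X s));
  nut_atom : forall X s, is_atom (projT2 (nut X s));
  nu_div : forall X s (g : @outm (ribbon_cat D Ap) X),
    left_div (aout s) (fout g) -> left_div (fout (nu X s)) (fout g);
  nut_div : forall X s (g : @inm (ribbon_cat D Ap) X),
    right_div (ain s) (fin g) -> right_div (fin (nut X s)) (fin g);
  nu_lcm : forall X s t, exists g : @outm (ribbon_cat D Ap) X,
    is_join (@left_div (mon_cat Ap) tt)
      (fout (nu X s)) (fout (nu X t)) (fout g);
  nut_lcm : forall X s t, exists g : @inm (ribbon_cat D Ap) X,
    is_join (@right_div (mon_cat Ap) tt)
      (fin (nut X s)) (fin (nut X t)) (fin g)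
}.

(* SH(X), SH^nu(X), sh(X) and its right-handed version, where the object X is
   the parabolic submonoid A_X^+. *)
Variables (N : nu_structure) (X : ribbon_ob D).

Definition nu_val (s : atom_type) : A := sval (projT2 (nu N X s)).
Definition nut_val (s : atom_type) : A := sval (projT2 (nut N X s)).

Definition SH : set A := [set g | conj_set X g = X /\ exists s, nu_val s = g].

Definition SHnu : set A := SH `\` X.

Definition sh : set A := [set sval (sval s) | s in [set s | SH (nu_val s)]].

Definition sht : set A := [set sval (sval s) | s in [set s | SH (nut_val s)]].

End Nu.

(* Main.v *)
(* For an atom [s] of [A_X^+] the ribbon [nu_X(s)] divides [Delta_X], so it lies
   in [A_X^+] and conjugates [A_X^+] into itself, hence onto itself by
   noetherianity.  So [A_X^+] is contained in [W := A_sh(X)^+], and conjugation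
   by [Delta_sh(X)] maps it to a parabolic submonoid of [W], hence of [A^+]: thus
   [Delta_sh(X)] is a ribbon and is divisible by all [nu_X(s)] with [s] in
   [sh(X)].  Peeling off such factors shows that every ribbon from [A_X^+] lying
   in [W] is a product of shakers, so that [A_SH(X)^+ = {g in W | g normalizes
   A_X^+}]; the hypothesis on [sh] gives the mirror statement for ribbons to
   [A_X^+].  Finally [A_SHnu(X)^+] consists of the elements of [A_SH(X)^+] without
   nontrivial divisor in [A_X^+], because [x g = g x^g] is the lcm of such a [g]
   with [x] in [A_X^+].

   Parabolicity is handled through an equivalent description: a submonoid is
   parabolic if and only if it is closed under factors and under both lcms. *)

Require Import Defs.
From mathcomp Require Import all_boot.
From mathcomp Require Import boolp classical_sets.

Set Implicit Arguments.
Unset Strict Implicit.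
Unset Printing Implicit Defensive.

Local Open Scope classical_set_scope.
Local Open Scope group_scope.

(** Inside one ambient group cancellation is free, a quotient is the total expression [a^-1 * b],
    and divisibility is a membership condition.

    The shaker monoid is handled as [V], the normalizer of [X] in [W], because membership in a
    generated monoid is hard to test. The obstacle is that [V] is in general not closed under
    factors in [A^+]: in the Artin monoid of type B2 with [X] generated by [s], the shaker [t s t]
    has the factor [t], which does not normalize [X]. So [V] is parabolic only among ribbons, where
    a divisor must itself be a ribbon from [X]. What remains true in [A^+] is closure under
    quotients and lcms; the lcms are obtained from the pairs [nu_X(s)], [nu_X(t)], the only ones
    covered by the [nu]-structure, by a tiling argument. The submonoid of reduced elements is, in
    contrast, closed under factors inside [V].

    The definition of parabolicity does not mention closure under factors; it is extracted from the
    condition on the meets with [Delta]. The groupoid statements all come from one universal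
    property of fractions. *)

Ltac gsimp :=
  rewrite ?(conjgE, invgM, invgK, invg1) -?mulgA
          ?(mulKg, mulVKg, mulVg, mulgV, mulg1, mul1g).

(** * Divisibility, noetherianity and closed submonoids inside a group *)

Section Submonoids.
Variable A : groupType.
Implicit Types (M V W X : set A) (a b c d g m s t u v x y z : A).

Definition dv M a b := M a /\ M (a^-1 * b).

(* [g |-> g^-1] turns right-divisibility in [M] into left-divisibility in
   [iv M], so that every one-sided statement also yields its mirror image. *)
Definition iv M : set A := [set g | M g^-1].

Definition proper_factor M a b :=
  [/\ M a, exists2 u, M u & exists2 v, M v & b = u * a * v & a <> b].

(** Noetherianity as induction on proper factors. It ranges over the whole group: an element outside
    [M] has no proper factor, so membership can be carried inside [P]. *)
Record noeth M : Prop := Noeth {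
  noeth_sub : is_submonoid M;
  noeth_ind : forall P : A -> Prop,
    (forall b, (forall a, proper_factor M a b -> P a) -> P b) -> forall b, P b
}.

Definition atom M s :=
  [/\ M s, s <> 1 & forall a b, M a -> M b -> a * b = s -> a = 1 \/ b = 1].

Definition factor_closed M V :=
  forall a b, M a -> M b -> V (a * b) -> V a /\ V b.

Definition join_closed M V :=
  forall a b m, V a -> V b -> is_join (dv M) a b m -> V m.

Record closed M V : Prop := Closed {
  cl_le : V `<=` M;
  cl_sub : is_submonoid V;
  cl_fc : factor_closed M V;
  cl_jl : join_closed M V;
  cl_jr : join_closed (iv M) (iv V)
}.

Definition has_joins M :=
  forall a b, M a -> M b -> exists m, is_join (dv M) a b m.

Record garside M d : Prop := Garside {
  ga_noeth : noeth M;
  ga_mem : M d;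
  ga_conj : forall g, M g -> M (g ^ d);
  ga_conjV : forall g, M g -> M (g ^ d^-1);
  ga_jl : has_joins M;
  ga_jr : has_joins (iv M);
  ga_atom : forall s, atom M s -> dv M s d
}.

(** The condition on [d] concerns left-divisors only; [parab_iv] recovers its mirror image. *)
Record parab M D V d : Prop := Parab {
  pa_closed : closed M V;
  pa_mem : V d;
  pa_dv : dv M d D;
  pa_max : forall v, V v -> dv M v D -> dv M v d
}.

Lemma ivK M : iv (iv M) = M.
Proof. by apply/seteqP; split=> g; rewrite /iv /= invgK. Qed.

Lemma iv_sub M : is_submonoid M -> is_submonoid (iv M).
Proof.
move=> [M1 MM]; split; first by rewrite /iv /= invg1.
by move=> x y Mx My; rewrite /iv /= invgM; apply: MM.
Qed.

Lemma iv_noeth M : noeth M -> noeth (iv M).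
Proof.
move=> [Ms Mind]; split; first exact: iv_sub.
move=> P IH b; rewrite -[b]invgK; elim/Mind: b^-1 => {}b IHb.
apply: IH => a [Ma [u Mu [v Mv E]] ab]; rewrite -[a]invgK; apply: IHb.
split=> //; last by move=> /(congr1 inv); rewrite invgK.
exists v^-1 => //; exists u^-1 => //.
by apply: invg_inj; rewrite E; gsimp.
Qed.

Lemma iv_atom M s : atom M s -> atom (iv M) s^-1.
Proof.
move=> [Ms s1 H]; split; first by rewrite /iv /= invgK.
  by move=> /(congr1 inv); rewrite invgK invg1.
move=> a b Ma Mb ab; have := H _ _ Mb Ma; rewrite -invgM ab invgK.
by case=> // /(congr1 inv); rewrite invgK invg1 => ->; [right | left].
Qed.

Lemma iv_atomV M s : atom (iv M) s -> atom M s^-1.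
Proof. by move=> /iv_atom; rewrite ivK. Qed.

Lemma iv_fc M V : factor_closed M V -> factor_closed (iv M) (iv V).
Proof.
by move=> H a b Ma Mb; rewrite /iv /= invgM => Vab; have [] := H _ _ Mb Ma Vab.
Qed.

Lemma iv_closed M V : closed M V -> closed (iv M) (iv V).
Proof.
move=> [H1 H2 H3 H4 H5]; split=> //; last by rewrite !ivK.
- by move=> g; apply: H1.
- exact: iv_sub.
- exact: iv_fc.
Qed.

Section Noeth.
Variable M : set A.
Hypothesis HM : noeth M.
Let M1 : M 1 := (noeth_sub HM).1.
Let MM a b : M a -> M b -> M (a * b) := @proj2 _ _ (noeth_sub HM) a b.

Lemma pf_irr2 a b : proper_factor M a b -> proper_factor M b a -> False.
Proof.
elim/(noeth_ind HM): a b => a IH b ab ba.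
exact: (IH b ba a ba ab).
Qed.

(** If [u * a] differed from [a], each would be a proper factor of the other. *)
Lemma noeth_cycle a u v : M a -> M u -> M v -> a = u * a * v -> u * a = a.
Proof.
move=> Ma Mu Mv E; apply: contrapT => ne.
apply: (@pf_irr2 a (u * a)).
  by split=> //; [exists u => //; exists 1 => //; rewrite mulg1 | move=> /esym].
split=> //; first exact: MM.
by exists 1 => //; exists v => //; rewrite mul1g.
Qed.

Lemma noeth_unit a : M a -> M a^-1 -> a = 1.
Proof.
move=> Ma MaV; have := @noeth_cycle 1 a a^-1 M1 Ma MaV.
by rewrite mulg1 mulgV; apply.
Qed.

Lemma dv_refl a : M a -> dv M a a.
Proof. by move=> Ma; split=> //; rewrite mulVg. Qed.

Lemma dv_anti a b : dv M a b -> dv M b a -> a = b.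
Proof.
move=> [Ma ab] [Mb ba]; have : a^-1 * b = 1.
  by apply: noeth_unit => //; rewrite invgM invgK.
by move=> /(congr1 (mul a)); rewrite mulVKg mulg1.
Qed.

Lemma dv_trans a b c : dv M a b -> dv M b c -> dv M a c.
Proof.
move=> [Ma ab] [Mb bc]; split=> //.
have -> : a^-1 * c = a^-1 * b * (b^-1 * c) by gsimp.
exact: MM.
Qed.

Lemma dv_mem a b : dv M a b -> M b.
Proof. by move=> [Ma ab]; rewrite -(mulVKg a b); apply: MM. Qed.

Lemma dv_mulr a b : M a -> M b -> dv M a (a * b).
Proof. by move=> Ma Mb; split=> //; rewrite mulKg. Qed.

Lemma dv_mulrr a b c : dv M a b -> M c -> dv M a (b * c).
Proof. by move=> [Ma ab] Mc; split=> //; rewrite mulgA; apply: MM. Qed.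

Lemma dv1 a : M a -> dv M 1 a.
Proof. by move=> Ma; split=> //; rewrite invg1 mul1g. Qed.

Lemma dv_mul2l g a b : M g -> dv M a b -> dv M (g * a) (g * b).
Proof. by move=> Mg [Ma ab]; split; [exact: MM | gsimp]. Qed.

Lemma dv_1 a : dv M a 1 -> a = 1.
Proof. by move=> [Ma]; rewrite mulg1; apply: noeth_unit. Qed.

Lemma atom_ex g : M g -> g <> 1 -> exists2 s, atom M s & dv M s g.
Proof.
elim/(noeth_ind HM): g => g IH Mg g1.
have [ag|nag] := pselect (atom M g); first by exists g => //; apply: dv_refl.
have [a [b [Ma Mb ab a1 b1]]] :
    exists a b, [/\ M a, M b, a * b = g, a <> 1 & b <> 1].
  apply: contrapT => H; apply: nag; split=> // a b Ma Mb ab.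
  apply: contrapT => /not_orP [a1 b1]; apply: H; by exists a, b.
have pa : proper_factor M a g.
  split=> //; first by exists 1 => //; exists b => //; rewrite mul1g.
  by move=> ag; apply: b1; apply: (mulgI a); rewrite ab mulg1.
have [s As sa] := IH a pa Ma a1.
by exists s => //; rewrite -ab; apply: dv_mulrr.
Qed.

Lemma atom_ind (P : A -> Prop) : P 1 ->
  (forall s g, atom M s -> M g -> P g -> P (s * g)) -> forall g, M g -> P g.
Proof.
move=> P1 PM; elim/(noeth_ind HM) => g IH Mg.
have [->//|g1] := pselect (g = 1).
have [s As [Ms sg]] := atom_ex Mg g1.
rewrite -(mulVKg s g); apply: PM => //; apply: IH => //; split=> //.
  by exists s => //; exists 1 => //; gsimp.
move=> E; case: As => _ s1 _; apply: s1; apply: (mulIg (s^-1 * g)).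
by rewrite mulVKg mul1g.
Qed.

Lemma join_uniq a b m m' :
  is_join (dv M) a b m -> is_join (dv M) a b m' -> m = m'.
Proof. by move=> [? [? H]] [? [? H']]; apply: dv_anti; [apply: H|apply: H']. Qed.

Lemma join_mul2l g a b m : M g ->
  is_join (dv M) a b m -> is_join (dv M) (g * a) (g * b) (g * m).
Proof.
move=> Mg [am [bm H]]; split; first exact: dv_mul2l.
split; first exact: dv_mul2l.
move=> c ac bc; have Mgc : M (g^-1 * c).
  have -> : g^-1 * c = a * ((g * a)^-1 * c) by gsimp.
  exact: MM am.1 ac.2.
have := H (g^-1 * c); rewrite /dv !mulgA -!invgM => /(_ (conj am.1 ac.2)).
move=> /(_ (conj bm.1 bc.2)) [Mm mc]; split=> //; exact: MM.
Qed.

(* The complements [a^-1 * g] of an increasing chain of left-divisors of [g]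
   are successive factors, so the chain is stationary. *)
Lemma directed_max (L : set A) g : L !=set0 ->
  (forall a, L a -> dv M a g) ->
  (forall a b, L a -> L b -> exists m, [/\ L m, dv M a m & dv M b m]) ->
  exists2 d, L d & forall a, L a -> dv M a d.
Proof.
move=> [d0 Ld0] Lg Ldir.
suff H e : forall d, L d -> d^-1 * g = e ->
    exists2 d, L d & forall a, L a -> dv M a d by exact: (H _ d0).
elim/(noeth_ind HM): e => e IH d Ld E.
have [//|nmax] := pselect (forall a, L a -> dv M a d); first by exists d.
have [a La nad] : exists2 a, L a & ~ dv M a d.
  by apply: contrapT => H; apply: nmax => a La; apply: contrapT => nad; apply: H; exists a.
have [m [Lm am dm]] := Ldir a d La Ld.
apply: (IH (m^-1 * g) _ m) => //; split; first exact: (Lg m Lm).2.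
  by exists (d^-1 * m); [exact: dm.2 | exists 1 => //; rewrite -E; gsimp].
rewrite -E => /mulIg /invg_inj md; apply: nad; by rewrite -md.
Qed.

End Noeth.

Section Closed.
Variable M : set A.
Hypothesis HM : noeth M.
Let MM a b : M a -> M b -> M (a * b) := @proj2 _ _ (noeth_sub HM) a b.

Lemma fc_dv V a b : V `<=` M -> factor_closed M V -> V b -> dv M a b -> dv V a b.
Proof.
move=> VM fc Vb [Ma ab]; have := fc a (a^-1 * b) Ma ab.
by rewrite mulVKg => /(_ Vb) [].
Qed.

Lemma sub_noeth V : V `<=` M -> is_submonoid V -> noeth V.
Proof.
move=> VM Vs; split=> // P IH; elim/(noeth_ind HM) => b IHb.
apply: IH => a [Va [u Vu [v Vv E]] ab]; apply: IHb; split=> //; first exact: VM.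
by exists u; [exact: VM | exists v; [exact: VM |]].
Qed.

(* In contrast with [factor_closed], factors are only required to lie in [V]
   when one of the two already does. *)
Definition div_closed V := forall a b, V a -> V b -> M (a^-1 * b) -> V (a^-1 * b).

Lemma fc_div_closed V : V `<=` M -> factor_closed M V -> div_closed V.
Proof.
move=> VM fc a b Va Vb ab; have := fc a (a^-1 * b) (VM _ Va) ab.
by rewrite mulVKg => /(_ Vb) [].
Qed.

Section Sub.
Variable V : set A.
Hypotheses (VM : V `<=` M) (Vs : is_submonoid V) (Vd : div_closed V).

Lemma dv_sub a b : V a -> V b -> dv M a b -> dv V a b.
Proof. by move=> Va Vb [Ma ab]; split=> //; apply: Vd. Qed.

Lemma dv_le a b : dv V a b -> dv M a b.
Proof. by move=> [Va ab]; split; apply: VM. Qed.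

Lemma join_sub a b m : V a -> V b -> V m ->
  is_join (dv M) a b m -> is_join (dv V) a b m.
Proof.
move=> Va Vb Vm [am [bm H]]; split; first exact: dv_sub.
split; first exact: dv_sub.
move=> c ac bc; apply: dv_sub => //.
  exact: dv_mem (sub_noeth VM Vs) _ _ ac.
by apply: H; exact: dv_le.
Qed.

Lemma join_of_sub a b m : has_joins M -> join_closed M V -> V a -> V b ->
  is_join (dv V) a b m -> is_join (dv M) a b m.
Proof.
move=> J jc Va Vb Hm; have [m' Hm'] := J a b (VM Va) (VM Vb).
by rewrite (join_uniq (sub_noeth VM Vs) Hm (join_sub Va Vb (jc _ _ _ Va Vb Hm') Hm')).
Qed.

Lemma sub_has_joins : has_joins M -> join_closed M V -> has_joins V.
Proof.
move=> J jc a b Va Vb; have [m Hm] := J a b (VM Va) (VM Vb).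
by exists m; apply: join_sub (Hm) => //; apply: jc (Hm).
Qed.

End Sub.

End Closed.

Lemma join_closed_trans M W V : noeth M -> W `<=` M -> is_submonoid W ->
  div_closed M W -> join_closed M W -> V `<=` W ->
  join_closed W V -> join_closed M V.
Proof.
move=> HM WM Ws Wd Wj VW Vj a b m Va Vb Hm; apply: (Vj a b) => //.
have [Wa Wb] := (VW _ Va, VW _ Vb).
have Wm := Wj _ _ _ Wa Wb Hm; exact: join_sub Hm.
Qed.

Lemma closed_trans M W V : noeth M -> closed M W -> closed W V -> closed M V.
Proof.
move=> HM [W1 W2 W3 W4 W5] [V1 V2 V3 V4 V5]; split=> //.
- exact: subset_trans V1 W1.
- move=> a b Ma Mb Vab; have [Wa Wb] := W3 a b Ma Mb (V1 _ Vab).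
  exact: V3.
- apply: join_closed_trans V4 => //; exact: fc_div_closed.
- apply: join_closed_trans V5 => //; first exact: iv_noeth.
  + by move=> g; apply: W1.
  + exact: iv_sub.
  + by apply: fc_div_closed; [move=> g; apply: W1 | apply: iv_fc].
  + by move=> g; apply: V1.
Qed.

(** An lcm in [W] must be recognised as an lcm in [M] before the closure of [V] applies; the
    existence of lcms in [M] gives something to compare it with. *)
Lemma closed_within M W V : noeth M -> has_joins M -> has_joins (iv M) ->
  closed M W -> closed M V -> V `<=` W -> closed W V.
Proof.
move=> HM Jl Jr [W1 W2 W3 W4 W5] [V1 V2 V3 V4 V5] VW; split=> //.
- by move=> a b /W1 Ma /W1 Mb; apply: V3.
- move=> a b m Va Vb Hm; apply: (V4 a b) => //.
  by apply: join_of_sub Hm => //; [exact: fc_div_closed | exact: VW | exact: VW].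
- move=> a b m Va Vb Hm; apply: (V5 a b) => //.
  apply: join_of_sub Hm => //; try exact: VW.
  + exact: iv_noeth.
  + by move=> g; apply: W1.
  + exact: iv_sub.
  by apply: fc_div_closed; [move=> g; apply: W1 | apply: iv_fc].
Qed.

Lemma conj_setE V g : conj_set V g = [set h | V (h ^ g^-1)].
Proof.
apply/seteqP; split=> [_ [v Vv <-]|h Vh]; first by rewrite /= conjgK.
by exists (h ^ g^-1) => //; rewrite conjgKV.
Qed.

Lemma dv_conj M g a b : dv (conj_set M g) a b <-> dv M (a ^ g^-1) (b ^ g^-1).
Proof. by rewrite /dv conj_setE /= conjMg conjVg. Qed.

Lemma join_conj M g a b m : is_join (dv (conj_set M g)) a b m ->
  is_join (dv M) (a ^ g^-1) (b ^ g^-1) (m ^ g^-1).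
Proof.
move=> [/dv_conj am [/dv_conj bm H]]; split=> //; split=> // c.
rewrite -[c](conjgK g) => ac bc; apply/dv_conj; apply: H; exact/dv_conj.
Qed.

Lemma iv_conj M g : iv (conj_set M g) = conj_set (iv M) g.
Proof. by rewrite !conj_setE /iv; apply/seteqP; split=> h /=; rewrite conjVg. Qed.

Lemma closed_conj M V g : closed M V -> closed (conj_set M g) (conj_set V g).
Proof.
have jc N U : join_closed N U -> join_closed (conj_set N g) (conj_set U g).
  by move=> H a b m; rewrite (conj_setE U) /= => Ua Ub /join_conj; apply: H.
move=> [H1 [H2 H2'] H3 H4 H5]; split.
- by rewrite !conj_setE => h; apply: H1.
- rewrite !conj_setE; split=> /=; first by rewrite conj1g.
  by move=> x y; rewrite conjMg; apply: H2'.
- by move=> a b; rewrite !conj_setE /= conjMg; apply: H3.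
- exact: jc.
- by rewrite !iv_conj; apply: jc.
Qed.

End Submonoids.

(** * Garside elements of closed submonoids *)

Section GreatestDivisor.
Variables (A : groupType) (M : set A) (D : A).
Implicit Types (V W X : set A) (a b c d g m s t u v x y z : A).

Lemma garside_iv N d : garside N d -> garside (iv (A := A) N) d^-1.
Proof.
move=> [H1 H2 H3 H4 H5 H6 H7]; split=> //.
- exact: iv_noeth.
- by rewrite /iv /= invgK.
- by move=> g Ng; rewrite /iv /= -conjVg; apply: H4.
- by move=> g Ng; rewrite /iv /= -conjVg invgK; apply: H3.
- by rewrite ivK.
- move=> s As; have [_ sd] := H7 _ (iv_atomV As).
  split; first by case: As.
  by move: (H4 _ sd); rewrite /iv /=; gsimp.
Qed.

Hypothesis HG : garside M D.
Let HM := ga_noeth HG.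
Let M1 : M 1 := (noeth_sub HM).1.
Let MM a b : M a -> M b -> M (a * b) := @proj2 _ _ (noeth_sub HM) a b.

(** [D * v^-1] is the conjugate of [v^-1 * D] by [D^-1], so the left- and right-divisors of [D]
    coincide. *)
Lemma dv_flip v : M v -> dv M v D <-> M (D * v^-1).
Proof.
move=> Mv; split=> [[_ /(ga_conjV HG)]|/(ga_conj HG) H]; first by gsimp.
by split=> //; move: H; gsimp.
Qed.

(** The divisors of [D] in [V] are directed: the lcm of two of them stays in [V] and still divides
    [D]. *)
Lemma closed_max V : closed M V -> exists d, parab M D V d.
Proof.
move=> HV; have [VM [V1 _] _ jl _] := HV.
pose L := [set v | V v /\ dv M v D].
have [||a b [Va aD] [Vb bD]|d [Vd dD] dmax] := @directed_max _ M HM L D.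
- exists 1; split=> //; apply: dv1 => //; exact: ga_mem HG.
- by move=> a [].
- have [m Hm] := ga_jl HG aD.1 bD.1; exists m; case: (Hm) => am [bm H].
  split=> //; split; first exact: jl Hm.
  exact: H.
by exists d; split=> // v Vv vD; apply: dmax.
Qed.

End GreatestDivisor.

Section Parabolic.
Variables (A : groupType) (M : set A) (D : A).
Implicit Types (V W X : set A) (a b c d g m s t u v x y z : A).
Hypothesis HG : garside M D.
Let HM := ga_noeth HG.
Let M1 : M 1 := (noeth_sub HM).1.
Let MM a b : M a -> M b -> M (a * b) := @proj2 _ _ (noeth_sub HM) a b.

(* The right-maximal divisor [e^-1] of [D] in [V] left-divides [d] and has [d]
   as a right-divisor, so both coincide. *)
Lemma parab_right V d v : parab M D V d -> V v -> M (D * v^-1) -> M (d * v^-1).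
Proof.
move=> HV; have [clV Vd dD dmax] := HV.
have [e [_ Ve eD emax]] := closed_max (garside_iv HG) (iv_closed clV).
rewrite /iv /= in Ve; pose f := e^-1.
have VM := cl_le clV.
have Mf : M f by apply: VM.
have fd : dv M f d.
  apply: dmax => //; apply/(dv_flip HG) => //.
  by case: eD => _; rewrite /iv /f /= invgM !invgK.
have df : M (f * d^-1).
  have /emax : iv V d^-1 by rewrite /iv /= invgK.
  case; last by rewrite /iv /= /f invgM !invgK.
  split; first by rewrite /iv /= invgK; apply: VM.
  rewrite /iv /= invgM !invgK; apply/(dv_flip HG) => //; exact: VM.
have E : f = d.
  apply: contrapT => ne; apply: (@pf_irr2 _ M HM f d); split=> //.
  - by exists 1 => //; exists (f^-1 * d); [exact: fd.2 | gsimp].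
  - exact: VM.
  - by exists (f * d^-1) => //; exists 1 => //; gsimp.
  - by move=> /esym.
move=> Vv vD; rewrite -E.
have : dv (iv M) v^-1 e.
  apply: emax; first by rewrite /iv /= invgK.
  by split; rewrite /iv /= ?invgM !invgK; first exact: VM.
by case=> _; rewrite /iv /= invgM !invgK.
Qed.

Lemma parab_iv V d : parab M D V d -> parab (iv M) D^-1 (iv V) d^-1.
Proof.
move=> HV; have [clV Vd dD dmax] := HV; split.
- exact: iv_closed.
- by rewrite /iv /= invgK.
- split; first by rewrite /iv /= invgK; apply: cl_le clV _ Vd.
  rewrite /iv /= invgM !invgK; apply/(dv_flip HG) => //; exact: cl_le clV _ Vd.
- move=> v Vv [Mv vD]; split=> //; move: vD.
  have := parab_right HV Vv; rewrite /iv /= !(invgM, invgK); exact.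
Qed.

(** It suffices to treat atoms, and for an atom [s] the element [s ^ d] is the complement in [d] of
    the complement [s^-1 * d]. *)
Lemma parab_conj V d v : parab M D V d -> V v -> V (v ^ d) /\ V (v ^ d^-1).
Proof.
move=> HV; have [clV Vd dD dmax] := HV.
have [VM [V1 VV] fc _ _] := clV.
have Vdv a b : M a -> M b -> a * b = d -> V a /\ V b.
  by move=> Ma Mb ab; apply: fc => //; rewrite ab.
move=> Vv; have Mv := VM _ Vv.
elim/(atom_ind HM): v / Mv Vv => [|s g As Mg IH Vsg]; first by rewrite !conj1g.
have [Ms _ _] := As.
have [Vs Vg] := fc _ _ Ms Mg Vsg; have [IH1 IH2] := IH Vg.
have sd : dv M s d by apply: dmax => //; exact: ga_atom HG _ As.
have sd' : M (d * s^-1).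
  apply: (parab_right HV) => //; apply/(dv_flip HG) => //; exact: ga_atom HG _ As.
suff [V1s V2s] : V (s ^ d) /\ V (s ^ d^-1) by rewrite !conjMg; split; apply: VV.
(* A right-divisor of [d] right-divides [D], hence left-divides [D], hence left-divides [d] by
   maximality. *)
have dr b : M b -> M (d * b^-1) -> M (b^-1 * d).
  move=> Mb bd; have [_ Vb] : V (d * b^-1) /\ V b.
    by apply: fc => //; rewrite mulgVK.
  have /(dv_flip HG) := Mb.
  case=> _ H; have : dv M b d; last by case.
  apply: dmax => //; apply: H.
  have -> : D * b^-1 = (D * d^-1) * (d * b^-1) by gsimp.
  by apply: MM => //; apply/(dv_flip HG) => //; apply: VM.
split.
  have : M ((s^-1 * d)^-1 * d).
    apply: dr; first exact: sd.2.
    by gsimp.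
  have -> : (s^-1 * d)^-1 * d = s ^ d by gsimp.
  move=> Msd; apply: (Vdv (s^-1 * d) _ _ Msd _).2; [exact: sd.2 | by gsimp].
have Vb : V (d * s^-1) by apply: (Vdv _ s _ _ _).1 => //; rewrite mulgVK.
have : M (d * (d * s^-1)^-1).
  apply: (parab_right HV) => //; apply/(dv_flip HG) => //.
  by apply: (dv_trans HM) dD; split=> //; gsimp.
have -> : d * (d * s^-1)^-1 = s ^ d^-1 by gsimp.
by move=> Msd; apply: (Vdv _ (d * s^-1) Msd _ _).1 => //; gsimp.
Qed.

Lemma parab_garside V d : parab M D V d -> garside V d.
Proof.
move=> HV; have [clV Vd dD dmax] := HV.
have [VM Vs fc jl jr] := clV; split=> //.
- exact: sub_noeth VM Vs.
- by move=> g Vg; have [] := parab_conj HV Vg.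
- by move=> g Vg; have [] := parab_conj HV Vg.
- by apply: sub_has_joins jl => //; [exact: fc_div_closed | exact: ga_jl HG].
- apply: sub_has_joins jr => //; last exact: ga_jr HG.
  + exact: iv_noeth.
  + by move=> g; apply: VM.
  + exact: iv_sub.
  by apply: fc_div_closed; [move=> g; apply: VM | apply: iv_fc].
- move=> s [Vs' s1 H]; have Ms := VM _ Vs'.
  apply: (fc_dv VM fc) => //; apply: dmax => //; apply: (ga_atom HG); split=> // a b Ma Mb ab.
  by have [Va Vb] := fc a b Ma Mb (eq_ind_r V Vs' ab); apply: H.
Qed.

(** The Garside element [e] of [conj_set X t] divides the Garside element [d] of [X]. If they agree,
    the atoms of [X] divide [e] and so lie in [conj_set X t]. Otherwise induction applies to
    [conj_set X t], which contains its own conjugate by [t], and conjugating back gives the claim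
    for [X]. *)
Lemma closed_conj_eq X t : closed M X -> closed M (conj_set X t) ->
  conj_set X t `<=` X -> conj_set X t = X.
Proof.
move=> cX cY YX; have [d Hd] := closed_max HG cX.
elim/(noeth_ind HM): d => d IH in X cX cY YX Hd *.
pose Y := conj_set X t; have [e He] := closed_max HG cY.
have ed : dv M e d.
  by apply: (pa_max Hd); [apply: YX; exact: pa_mem He | exact: pa_dv He].
have Me := ed.1; have Md := cl_le cX (pa_mem Hd).
have [de|de] := pselect (e = d).
  apply/seteqP; split=> // x Xx; have Mx := cl_le cX Xx.
  elim/(atom_ind HM): x / Mx Xx => [|s g As Mg IHg Xsg].
    by have [] := cl_sub cY.
  have [Ms _ _] := As; have [Xs Xg] := cl_fc cX Ms Mg Xsg.
  apply: (cl_sub cY).2; last exact: IHg.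
  have sd : dv M s e by rewrite de; apply: (pa_max Hd) => //; exact: ga_atom HG _ As.
  have Ye : Y (s * (s^-1 * e)) by rewrite mulVKg; exact: pa_mem He.
  by have [] := cl_fc cY Ms sd.2 Ye.
have YY : conj_set Y t = Y.
  apply: (IH e) => //.
  - split=> //; exists 1 => //; exists (e^-1 * d); first exact: ed.2.
    by rewrite mul1g mulVKg.
  - have [Jl Jr] := (ga_jl HG, ga_jr HG).
    apply: closed_trans (cY) _ => //; apply: closed_conj.
    exact: closed_within (cX) cY YX.
  - by move: YX; rewrite /Y !conj_setE => YX h /=; apply: YX.
by move/(congr1 (fun Z => conj_set Z t^-1)): YY;
   rewrite /Y !conj_setE; move=> /seteqP [H1 H2]; apply/seteqP; split=> h;
   [move: (H1 h) | move: (H2 h)]; rewrite /= ?invgK ?conjgK.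
Qed.

Lemma parab_conj_closed W w X : parab M D W w -> closed M X -> X `<=` W ->
  closed M (conj_set X w).
Proof.
move=> HW cX XW; have [cW Ww _ _] := HW.
have E : conj_set W w = W.
  rewrite conj_setE; apply/seteqP; split=> h /= Wh.
    by have [] := parab_conj HW Wh; rewrite conjgKV.
  by have [] := parab_conj HW Wh.
have cWX := closed_within HM (ga_jl HG) (ga_jr HG) cW cX XW.
apply: closed_trans (cW) _ => //; rewrite -E; exact: closed_conj.
Qed.

(** The complement [s^-1 * D] of an atom is moved across [D ^+ k] by conjugation, which preserves
    [M]. *)
Lemma garside_pow v : M v -> exists k, dv M v (D ^+ k).
Proof.
elim/(atom_ind HM) => [|s g As Mg [k [_ IH]]].
  by exists 0%N; rewrite expg0; apply: dv_refl.
exists k.+1; have [Ms sD] := ga_atom HG As; split; first exact: MM.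
have Mc : M ((s^-1 * D) ^ (D ^+ k)).
  elim: k {IH} => [|k IH]; first by rewrite expg0 conjg1.
  by rewrite expgSr conjgM; apply: ga_conj HG _ IH.
have -> : (s * g)^-1 * D ^+ k.+1 = (g^-1 * D ^+ k) * ((s^-1 * D) ^ (D ^+ k)).
  by rewrite expgS; gsimp.
exact: MM.
Qed.

End Parabolic.

(** * Fractions, normalizers and generated submonoids *)

Section Fractions.
Variables (A : groupType) (V : set A).
Hypotheses (Vs : is_submonoid V).

Lemma gen_grp_frac (Y : set A) : Y `<=` V ->
  (forall a b, V a -> V b -> exists c e, [/\ V c, V e & a * c = b * e]) ->
  forall g, subm_set (gen_grp Y) g -> exists a b, [/\ V a, V b & g = a * b^-1].
Proof.
move=> YV ore g.
pose F := [set g | exists a b, [/\ V a, V b & g = a * b^-1]].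
suff HF : is_subgroup F /\ Y `<=` F by move=> /(_ F HF).
have [V1 VV] := Vs; split; last first.
  by move=> y Yy; exists y, 1; split=> //; [exact: YV | gsimp].
split; first split.
- by exists 1, 1; split=> //; gsimp.
- move=> _ _ [a [b [Va Vb ->]]] [c [d [Vc Vd ->]]].
  have [e [f [Ve Vf E]]] := ore b c Vb Vc.
  exists (a * e), (d * f); split; [exact: VV | exact: VV |].
  have -> : c = b * e * f^-1 by rewrite E; gsimp.
  by gsimp.
- by move=> _ [a [b [Va Vb ->]]]; exists b, a; split=> //; gsimp.
Qed.

Lemma joins_ore : has_joins V ->
  forall a b, V a -> V b -> exists c e, [/\ V c, V e & a * c = b * e].
Proof.
move=> J a b Va Vb; have [m [[_ am] [[_ bm] _]]] := J a b Va Vb.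
by exists (a^-1 * m), (b^-1 * m); split=> //; gsimp.
Qed.

End Fractions.

Section Normalizer.
Variable A : groupType.
Implicit Types (X Y : set A) (g h x : A).

Definition norm X g := conj_set X g = X.

Lemma conj_set_comp X g h : conj_set (conj_set X g) h = conj_set X (g * h).
Proof. by rewrite (@conj_setM _ X (conj_set X g) (conj_set (conj_set X g) h)). Qed.

Lemma norm1 X : norm X 1. Proof. exact: conj_set1. Qed.

Lemma normM X g h : norm X g -> norm X h -> norm X (g * h).
Proof. exact: conj_setM. Qed.

Lemma normV X g : norm X g -> norm X g^-1.
Proof.
by move=> Ng; rewrite /norm -[X in conj_set X _]Ng conj_set_comp mulgV conj_set1.
Qed.

Lemma norm_mem X g x : norm X g -> X x -> X (x ^ g).
Proof. by move=> Ng Xx; rewrite -Ng; exists x. Qed.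

Lemma norm_memV X g x : norm X g -> X x -> X (x ^ g^-1).
Proof. by move=> /normV; apply: norm_mem. Qed.

Lemma norm_iv X g : norm X g -> norm (iv X) g.
Proof. by rewrite /norm -iv_conj => ->. Qed.

Lemma normP X g : (forall x, X x -> X (x ^ g)) -> (forall x, X x -> X (x ^ g^-1)) ->
  norm X g.
Proof.
move=> H1 H2; rewrite /norm conj_setE; apply/seteqP; split=> x /=.
  by move=> /H1; rewrite conjgKV.
exact: H2.
Qed.

Lemma gen_mon_split (Y : set A) g : subm_set (gen_mon Y) g ->
  g = 1 \/ exists y h, [/\ Y y, subm_set (gen_mon Y) h & g = y * h].
Proof.
pose G := gen_mon Y; have [G1 GG] := submP G.
pose P := [set g | subm_set G g /\
  (g = 1 \/ exists y h, [/\ Y y, subm_set G h & g = y * h])].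
suff HP : is_submonoid P /\ Y `<=` P by move=> /(_ P HP) [].
split; last first.
  move=> y Yy; split; first by move=> Q [_]; apply.
  by right; exists y, 1; rewrite mulg1.
split; first by split=> //; left.
move=> a b [Ga [->|[y [h [Yy Gh E]]]]] [Gb Hb]; first by rewrite mul1g.
split; first exact: GG.
right; exists y, (h * b); split=> //; first exact: GG.
by rewrite E mulgA.
Qed.

Lemma gen_mon_le (Y U : set A) : is_submonoid U -> Y `<=` U -> gen_mon Y `<=` U.
Proof. by move=> HU YU g /(_ U (conj HU YU)). Qed.

Lemma gen_grp_le (Y U : set A) : is_subgroup U -> Y `<=` U -> gen_grp Y `<=` U.
Proof. by move=> HU YU g /(_ U (conj HU YU)). Qed.

Lemma gen_mon_mem (Y : set A) : Y `<=` gen_mon Y.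
Proof. by move=> y Yy U [_]; apply. Qed.

Lemma gen_grp_mem (Y : set A) : Y `<=` gen_grp Y.
Proof. by move=> y Yy U [_]; apply. Qed.

Lemma gen_grp_subgroup (Y : set A) : is_subgroup (gen_grp Y).
Proof.
split; first exact: submP (gen_grp Y).
by move=> x Gx U [[Us UV] YU]; exact: UV (Gx U (conj (conj Us UV) YU)).
Qed.

End Normalizer.

(** * Ribbons and the shaker monoid *)

Section NuSystem.
Variable A : groupType.
Implicit Types (M X W V : set A) (a b g m s t : A).

(** The ribbons with source [X]. The target is not recorded: since parabolic means closed, it
    suffices that the conjugate of [X] be closed. *)
Definition out M X g := M g /\ closed M (conj_set X g).

(* [R s n] means [n = nu_X(s)]; the mirror image is a system for [iv M]. *)
Record nu_system M X (R : A -> A -> Prop) : Prop := NuSystem {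
  ns_ex : forall s, atom M s -> exists n, R s n;
  ns_out : forall s n, R s n -> out M X n /\ n <> 1;
  ns_irr : forall s n f g, R s n -> out M X f -> M g -> f * g = n ->
    f = 1 \/ g = 1;
  ns_dv : forall s n g, R s n -> out M X g -> dv M s g -> dv M n g;
  ns_join : forall s n s' n', R s n -> R s' n' ->
    exists2 m, out M X m & is_join (dv M) n n' m
}.

Definition shaker_part X W : set A := [set g | W g /\ norm X g].

Lemma iv_shaker_part X W : shaker_part (iv X) (iv W) = iv (shaker_part X W).
Proof.
apply/seteqP; split=> g [Wg /norm_iv]; rewrite ?ivK => Ng; split=> //.
  exact: normV.
by rewrite -[g]invgK; apply: normV.
Qed.

Section OneSide.
Variables (M : set A) (D : A) (X : set A) (dX : A) (R : A -> A -> Prop).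
Hypotheses (HG : garside M D) (HX : parab M D X dX) (HR : nu_system M X R).
Let HM := ga_noeth HG.
Let M1 : M 1 := (noeth_sub HM).1.
Let MM a b : M a -> M b -> M (a * b) := @proj2 _ _ (noeth_sub HM) a b.

Lemma norm_out g : M g -> norm X g -> out M X g.
Proof. by move=> Mg Ng; split=> //; rewrite Ng; exact: pa_closed HX. Qed.

Lemma norm_garside : norm X dX.
Proof. by apply: normP => x Xx; have [] := parab_conj HG HX Xx. Qed.

Lemma atom_dv s : X s -> atom M s -> dv M s dX.
Proof. by move=> Xs As; apply: (pa_max HX) => //; apply: ga_atom HG _ As. Qed.

Lemma nu_mem s n : X s -> atom M s -> R s n -> X n.
Proof.
move=> Xs As Rsn; have Mdx := cl_le (pa_closed HX) (pa_mem HX).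
have [Mn nd] : dv M n dX.
  apply: (ns_dv HR Rsn); last exact: atom_dv.
  exact: norm_out norm_garside.
have := cl_fc (pa_closed HX) Mn nd.
by rewrite mulVKg => /(_ (pa_mem HX)) [].
Qed.

Lemma nu_norm s n : X s -> atom M s -> R s n -> norm X n.
Proof.
move=> Xs As Rsn; have Xn := nu_mem Xs As Rsn.
have [[Mn cY] _] := ns_out HR Rsn; have cX := pa_closed HX.
apply: (closed_conj_eq HG cX cY) => y Yy.
have My := cl_le cY Yy; have [x Xx xy] := Yy.
have : X (n * y) by rewrite -xy conjgE mulVKg; apply: (cl_sub cX).2.
by move=> /(cl_fc cX Mn My) [].
Qed.

Variables (W : set A) (w : A).
Hypotheses (HW : parab M D W w) (XW : X `<=` W).
(** For [W] generated by [sh(X)] this holds because every atom of [W] is a generator. For the mirror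
    image it comes from the equality of [sh(X)] with its right-handed version. *)
Hypothesis RW : forall s, atom M s -> W s -> exists2 n, R s n & norm X n.

Let V := shaker_part X W.
Let cW := pa_closed HW.
Let WM : W `<=` M := cl_le cW.
Let WW a b : W a -> W b -> W (a * b) := @proj2 _ _ (cl_sub cW) a b.

Definition shakers : set A := [set n | W n /\ norm X n /\ exists s, R s n].

Lemma out_garside : out M X w.
Proof.
split; first exact: WM (pa_mem HW).
exact: (parab_conj_closed HG HW (pa_closed HX) XW).
Qed.

Lemma nu_dv_garside s n : atom M s -> W s -> R s n -> dv M n w.
Proof.
move=> As Ws Rsn; apply: (ns_dv HR Rsn); first exact: out_garside.
by apply: (pa_max HW) => //; apply: ga_atom HG _ As.
Qed.

Lemma nu_W s n : atom M s -> W s -> R s n -> W n.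
Proof.
move=> As Ws Rsn; have [Mn nw] := nu_dv_garside As Ws Rsn.
have := cl_fc cW Mn nw.
by rewrite mulVKg => /(_ (pa_mem HW)) [].
Qed.

Lemma out_shaker g : W g -> out M X g -> g <> 1 -> exists n,
  [/\ shakers n, dv M n g & n <> 1].
Proof.
move=> Wg Og g1; have [s As sg] := atom_ex HM (WM Wg) g1.
have Ws : W s.
  by have := cl_fc cW sg.1 sg.2; rewrite mulVKg => /(_ Wg) [].
have [n Rsn Nn] := RW As Ws; exists n; split.
- by split; [exact: nu_W Rsn | split=> //; exists s].
- exact: (ns_dv HR Rsn Og sg).
- by have [] := ns_out HR Rsn.
Qed.

(* A ribbon inside [W] is a product of the loops [nu_X(s)]: peel off [nu_X(s)]
   for a left atom [s]. *)
Lemma out_gen g : W g -> out M X g -> norm X g /\ subm_set (gen_mon shakers) g.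
Proof.
elim/(noeth_ind HM): g => g IH Wg Og.
have [->|g1] := pselect (g = 1).
  by split; [exact: norm1 | exact: (submP (gen_mon _)).1].
have [n [Sn ng n1]] := out_shaker Wg Og g1; have [Wn [Nn _]] := Sn.
have Wg' : W (n^-1 * g).
  by have := cl_fc cW ng.1 ng.2; rewrite mulVKg => /(_ Wg) [].
have [|//||Ng' Gg'] := IH (n^-1 * g).
- split; first exact: ng.2.
    by exists n; [exact: ng.1 | exists 1 => //; gsimp].
  move=> E; apply: n1; apply: (mulIg (n^-1 * g)).
  by rewrite mulVKg mul1g.
- split; first exact: WM.
  by rewrite -[X in conj_set X _]Nn conj_set_comp mulVKg; case: Og.
rewrite -[g](mulVKg n); split; first exact: normM.
by apply: (submP (gen_mon _)).2 Gg'; apply: gen_mon_mem.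
Qed.

Lemma out_part g : W g -> out M X g -> V g.
Proof. by move=> Wg Og; split=> //; have [] := out_gen Wg Og. Qed.

Lemma garside_part : V w.
Proof. by apply: out_part; [exact: pa_mem HW | exact: out_garside]. Qed.

Lemma part_le : V `<=` M. Proof. by move=> g [/WM]. Qed.

Lemma part_out g : V g -> out M X g.
Proof. by move=> [/WM Mg Ng]; apply: norm_out. Qed.

Lemma part_gen : V = gen_mon shakers :> set A.
Proof.
apply/seteqP; split=> [g Vg|]; first by have [] := out_gen Vg.1 (part_out Vg).
apply: gen_mon_le; last by move=> n [Wn [Nn _]].
split; first by split; [exact: (cl_sub cW).1 | exact: norm1].
by move=> a b [Wa Na] [Wb Nb]; split; [exact: WW | exact: normM].
Qed.

Lemma part_sub : is_submonoid V.
Proof. by rewrite part_gen; apply: submP. Qed.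

Lemma part_div : div_closed M V.
Proof.
move=> a b [Wa Na] [Wb Nb] Mab; split.
  by apply: fc_div_closed Mab => //; exact: cl_fc cW.
by apply: normM => //; apply: normV.
Qed.

(** The lcm is a ribbon by the [nu]-structure and lies in [W] by closure; a ribbon from [X] inside
    [W] is a loop. *)
Lemma shaker_join n n' : shakers n -> shakers n' ->
  exists2 m, V m & is_join (dv M) n n' m.
Proof.
move=> [Wn [_ [s Rn]]] [Wn' [_ [s' Rn']]].
have [m Om Hm] := ns_join HR Rn Rn'; exists m => //.
by apply: out_part => //; apply: (cl_jl cW) Wn Wn' Hm.
Qed.

(** Lcms pass from generators to all elements by tiling. The induction is on a common multiple [k]:
    dividing by a shaker makes [k] smaller, and two tiles, one below [s] and one below [t], complete
    the lcm of [s] and [t] to that of [a] and [b]. *)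
Lemma part_join : join_closed M V.
Proof.
move=> a b m Va Vb Hm.
suff H k : (forall a b, V a -> V b -> dv M a k -> dv M b k -> 
  exists2 m, V m & is_join (dv M) a b m).
  have [m' Vm' Hm'] := H m a b Va Vb Hm.1 Hm.2.1.
  by rewrite (join_uniq HM Hm Hm').
elim/(noeth_ind HM): k {a b m Va Vb Hm} => k IH a b Va Vb ak bk.
have [V1 VV] := part_sub; have VM := part_le.
have [a1|a1] := pselect (a = 1).
  exists b => //; rewrite a1; split; first by apply: dv1 => //; exact: VM.
  by split=> //; apply: (dv_refl HM); exact: VM.
have [b1|b1] := pselect (b = 1).
  exists a => //; rewrite b1; split; first by apply: (dv_refl HM); exact: VM.
  by split=> //; apply: dv1 => //; exact: VM.
have [s [Ss sa s1]] := out_shaker Va.1 (part_out Va) a1.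
have [t [St tb t1]] := out_shaker Vb.1 (part_out Vb) b1.
have Vs : V s by case: Ss => ? [].
have Vt : V t by case: St => ? [].
have [st Vst [s_st [t_st Hst]]] := shaker_join Ss St.
have stk : dv M st k by apply: Hst; [exact: dv_trans sa ak | exact: dv_trans tb bk].
have pk u : V u -> u <> 1 -> dv M u k -> proper_factor M (u^-1 * k) k.
  move=> Vu u1 [Mu uk]; split=> //; first by exists u => //; exists 1 => //; gsimp.
  by move=> E; apply: u1; apply: (mulIg (u^-1 * k)); rewrite mulVKg mul1g.
have shift u c e : V u -> V c -> dv M u c -> dv M c e -> dv M (u^-1 * c) (u^-1 * e).
  by move=> Vu Vc [_ uc] [_ ce]; split=> //; gsimp.
have dcl u c : V u -> V c -> dv M u c -> V (u^-1 * c).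
  by move=> Vu Vc [_ uc]; apply: part_div.
(* Tile below [s]: [s * p], called [q] afterwards, is the lcm of [a] and [st]. *)
have [p Vp Hp] := IH _ (pk s Vs s1 (dv_trans HM sa ak)) (s^-1 * a) (s^-1 * st)
  (dcl _ _ Vs Va sa) (dcl _ _ Vs Vst s_st) (shift _ _ _ Vs Va sa ak)
  (shift _ _ _ Vs Vst s_st stk).
have {Hp} := join_mul2l HM (VM _ Vs) Hp; rewrite !mulVKg => Hp.
have Vq : V (s * p) by exact: VV.
move: (s * p) Vq Hp => q Vq [aq [stq Hq]].
have qk : dv M q k by apply: Hq.
have tq : dv M t q by apply: dv_trans stq.
(* Tile below [t]: [t * r] is the lcm of [q] and [b]. It is the lcm of [a] and [b], since every
   common multiple of these is a multiple of [s] and [t], hence of [st]. *)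
have [r Vr Hr] := IH _ (pk t Vt t1 (dv_trans HM tb bk)) (t^-1 * q) (t^-1 * b)
  (dcl _ _ Vt Vq tq) (dcl _ _ Vt Vb tb) (shift _ _ _ Vt Vq tq qk)
  (shift _ _ _ Vt Vb tb bk).
have {Hr} := join_mul2l HM (VM _ Vt) Hr; rewrite !mulVKg => -[qr [br Hr]].
exists (t * r); first exact: VV.
split; first exact: dv_trans aq qr.
split=> // c ac bc; apply: Hr => //; apply: Hq => //; apply: Hst.
  exact: dv_trans sa ac.
exact: dv_trans tb bc.
Qed.

(** A shaker is irreducible among all ribbons, hence in [V]; conversely a nontrivial element of [V]
    has a shaker as left-divisor. *)
Lemma part_atom s : atom V s <-> shakers s.
Proof.
split=> [[Vs s1 H]|Ss].
  have [n [Sn [Mn ns] n1]] := out_shaker Vs.1 (part_out Vs) s1.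
  have Vn : V n by case: Sn => ? [].
  have Vns : V (n^-1 * s) by apply: part_div.
  have [//|E] := H n (n^-1 * s) Vn Vns (mulVKg _ _).
  by have -> : s = n by rewrite -[s](mulVKg n) E mulg1.
have [Ws [Ns [t Rt]]] := Ss; split=> //; first by have [] := ns_out HR Rt.
move=> a b Va Vb ab; apply: (ns_irr HR Rt) ab; first exact: part_out.
exact: part_le.
Qed.

(** The atom that indexes [n] is not known to lie in [W] or to divide [n]. An atom [s'] of [W]
    dividing [n] is taken instead, and irreducibility of [n] forces its ribbon to be [n]. *)
Lemma shaker_dv n : shakers n -> dv V n w.
Proof.
move=> Sn; have [Wn [Nn [s Rn]]] := Sn; have Vn : V n by [].
have [->|n1] := pselect (n = 1).
   have [V1 _] := part_sub; split=> //; rewrite invg1 mul1g; exact: garside_part.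
have [s' As sn] := atom_ex HM (WM Wn) n1.
have Ws : W s'.
  by have := cl_fc cW sn.1 sn.2; rewrite mulVKg => /(_ Wn) [].
have [n' Rn' Nn'] := RW As Ws.
have n'n : dv M n' n by apply: (ns_dv HR Rn') sn; apply: part_out.
have Vn' : V n' by split=> //; exact: nu_W Rn'.
have Vnn : V (n'^-1 * n) by apply: part_div n'n.2.
have [_ _ H] := (part_atom n).2 Sn.
have [E|E] := H n' (n'^-1 * n) Vn' Vnn (mulVKg _ _).
  by have [_ /(_ E)] := ns_out HR Rn'.
have -> : n = n' by rewrite -[n](mulVKg n') E mulg1.
apply: dv_sub => //; first exact: part_div.
  exact: garside_part.
exact: nu_dv_garside Rn'.
Qed.

(** A divisor of [g] in [X] need not normalize [X], so the quotient may leave [V]. The ribbon of one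
    of its atoms is a divisor in [X] that does normalize it. *)
Lemma part_reduce g x : V g -> X x -> x <> 1 -> dv M x g ->
  exists y, [/\ X y, V y, y <> 1 & dv M y g].
Proof.
move=> Vg Xx x1 xg; have [s As sx] := atom_ex HM (cl_le (pa_closed HX) Xx) x1.
have Xs : X s.
  by have := cl_fc (pa_closed HX) sx.1 sx.2; rewrite mulVKg => /(_ Xx) [].
have [n Rn] := ns_ex HR As; exists n.
have Xn := nu_mem Xs As Rn; split=> //.
- by split; [exact: XW | exact: nu_norm Rn].
- by have [] := ns_out HR Rn.
- apply: (ns_dv HR Rn); first exact: part_out.
  exact: dv_trans sx xg.
Qed.

End OneSide.
End NuSystem.

(** * Reduced elements and the semidirect product *)

Section Reduced.
Variable A : groupType.
Implicit Types (M X W V : set A) (a b g h m x y : A).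

Definition reduced M X g := forall x, X x -> dv M x g -> x = 1.

Definition reduced_part M X V : set A := [set g | V g /\ reduced M X g].

(** The properties of the shaker monoid used from here on, gathered so that they can also be
    supplied for its mirror image. *)
Record normalizing_part M X V : Prop := NormalizingPart {
  np_noeth : noeth M;
  np_joins : has_joins M;
  np_closed : closed M X;
  np_le : V `<=` M;
  np_sub : is_submonoid V;
  np_norm : forall g, V g -> norm X g;
  np_div : div_closed M V;
  np_join : join_closed M V;
  np_reduce : forall g x, V g -> X x -> x <> 1 -> dv M x g ->
    exists y, [/\ X y, V y, y <> 1 & dv M y g]
}.

Section OneSide.
Variables M X V : set A.
Hypothesis HV : normalizing_part M X V.
Let HM := np_noeth HV.
Let MM a b : M a -> M b -> M (a * b) := @proj2 _ _ (noeth_sub HM) a b.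
Let cX := np_closed HV.
Let XM : X `<=` M := cl_le cX.
Let VM : V `<=` M := np_le HV.

(* The lcm of [x] and [g] is [x * g = g * x ^ g]. *)
Lemma reduced_dvM g h x : V g -> reduced M X g -> X x ->
  dv M x (g * h) -> M h -> dv M (x ^ g) h.
Proof.
move=> Vg rg Xx xgh Mh; have [Mx Mg] := (XM Xx, VM Vg).
have Xxg : X (x ^ g) by apply: norm_mem => //; apply: np_norm HV _ Vg.
have Mxg := XM Xxg.
have [m [xm [gm Hm]]] := np_joins HV Mx Mg.
have mgx : dv M m (g * x ^ g).
  apply: Hm; last exact: dv_mulr.
  by rewrite -conjgC; apply: dv_mulr.
pose w := g^-1 * m; have mE : m = g * w by rewrite /w mulVKg.
have wx : dv M w (x ^ g).
  by split; [exact: gm.2 | case: mgx => _; rewrite mE; gsimp].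
have [Xw Xz] : X w /\ X (w^-1 * x ^ g).
  by apply: (cl_fc cX wx.1 wx.2); rewrite mulVKg.
(* The part of [x ^ g] left over by the lcm [m = g * w], carried to the left of [g], is an element
   of [X] dividing [g]; as [g] is reduced, it is trivial. *)
pose z' := (w^-1 * x ^ g) ^ g^-1.
have Xz' : X z' by apply: norm_memV => //; apply: np_norm HV _ Vg.
have z'g : dv M z' g.
  split; first exact: XM.
  have -> : z'^-1 * g = x^-1 * m by rewrite mE /z'; gsimp.
  exact: xm.2.
have wE : x ^ g = w.
  have := rg _ Xz' z'g; rewrite /z' => /(congr1 (fun t => t ^ g)).
  rewrite conjgKV conj1g => E.
  by rewrite -[LHS](mulVKg w) E mulg1.
rewrite wE; split; first exact: wx.1.
have : dv M m (g * h) by apply: Hm => //; exact: dv_mulr.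
by case=> _; rewrite mE; gsimp.
Qed.

Lemma reduced_dv_mull g h a : V g -> reduced M X g -> X a -> M h ->
  dv M a (g * h) -> dv M (a * g) (g * h).
Proof.
move=> Vg rg Xa Mh agh; have := reduced_dvM Vg rg Xa agh Mh.
by rewrite conjgC => /(dv_mul2l HM (VM Vg)).
Qed.

(** The lcm of [p] and [a] is [a * y] with [y] in [X], and [y] divides [g], so [y = 1]. *)
Lemma reduced_max g a p : reduced M X g -> X a -> X p -> M g ->
  dv M p (a * g) -> dv M p a.
Proof.
move=> rg Xa Xp Mg pag; have [Ma Mp] := (XM Xa, XM Xp).
have [m Hm] := np_joins HV Mp Ma; have [pm [am H]] := Hm.
have Xm : X m := cl_jl cX Xp Xa Hm.
have mag : dv M m (a * g) by apply: H => //; exact: dv_mulr.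
have Xam : X (a^-1 * m).
  by have := cl_fc cX Ma am.2; rewrite mulVKg => /(_ Xm) [].
have : a^-1 * m = 1.
  apply: rg => //; split; first exact: am.2.
  by case: mag => _; gsimp.
by move=> E; move: pm; rewrite -[m](mulVKg a) E mulg1.
Qed.

Lemma reducedM a b : V a -> reduced M X a -> M b -> reduced M X b ->
  reduced M X (a * b).
Proof.
move=> Va ra Mb rb x Xx xab.
have := rb _ _ (reduced_dvM Va ra Xx xab Mb) => /(_ (norm_mem (np_norm HV Va) Xx)).
by move/(congr1 (fun t => t ^ a^-1)); rewrite conjgK conj1g.
Qed.

Lemma reduced_left a b : M b -> reduced M X (a * b) -> reduced M X a.
Proof. by move=> Mb rab x Xx xa; apply: rab => //; apply: dv_mulrr. Qed.

Lemma reduced_right a b : V a -> M b -> reduced M X (a * b) -> reduced M X b.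
Proof.
move=> Va Mb rab x Xx [Mx xb].
have Xx' : X (x ^ a^-1) by apply: norm_memV => //; apply: np_norm HV _ Va.
have : x ^ a^-1 = 1.
  apply: rab => //; split; first exact: XM.
  have -> : (x ^ a^-1)^-1 * (a * b) = a * (x^-1 * b) by gsimp.
  by apply: MM => //; exact: VM.
by move/(congr1 (fun t => t ^ a)); rewrite conjgKV conj1g.
Qed.

Lemma reduced1 : reduced M X 1.
Proof. by move=> x _ /(dv_1 HM). Qed.

Lemma reduced_part_sub : is_submonoid (reduced_part M X V).
Proof.
have [V1 VV] := np_sub HV; split; first by split=> //; exact: reduced1.
move=> a b [Va ra] [Vb rb]; split; first exact: VV.
by apply: reducedM => //; exact: VM.
Qed.

Lemma reduced_part_fc : factor_closed V (reduced_part M X V).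
Proof.
move=> a b Va Vb [_ rab]; split; split=> //.
  exact: reduced_left (VM Vb) rab.
exact: reduced_right Va (VM Vb) rab.
Qed.

(** If [x] in [X] divides the lcm [m], then [x * a] and [x * b] divide [m] because [a] and [b] are
    reduced. Hence [a] and [b], and so [m], divide [x^-1 * m], which noetherianity allows only for
    [x = 1]. *)
Lemma reduced_part_join : join_closed V (reduced_part M X V).
Proof.
move=> a b m [Va ra] [Vb rb] Hm.
have {Hm} Hm := join_of_sub HM VM (np_sub HV) (np_div HV) (np_joins HV) (np_join HV) Va Vb Hm.
split; first exact: np_join HV _ _ _ Va Vb Hm.
move=> x Xx xm; have [am [bm H]] := Hm.
have quo c : V c -> reduced M X c -> dv M c m -> dv M c (x^-1 * m).
  move=> Vc rc cm; have := @reduced_dv_mull c (c^-1 * m) x Vc rc Xx cm.2.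
  rewrite mulVKg => /(_ xm) [_ H']; split; first exact: VM.
  by move: H'; gsimp.
have mx : dv M m (x^-1 * m) by apply: H; apply: quo.
have := @noeth_cycle _ M HM (x^-1 * m) x (m^-1 * (x^-1 * m)) xm.2 (XM Xx) mx.2.
by gsimp => /(_ erefl) /(congr1 (fun t => t * m^-1)); gsimp => /(congr1 inv); gsimp.
Qed.

(* A right-divisor [y] of [g] in [X] normalizing [X] is conjugate, through
   [g * y^-1], to a left-divisor in [X]. *)
Lemma reduced_mirror g : normalizing_part (iv M) (iv X) (iv V) ->
  V g -> reduced M X g -> reduced (iv M) (iv X) g^-1.
Proof.
move=> HV' Vg rg x Xx xg; apply: contrapT => x1.
have Vg' : iv V g^-1 by rewrite /iv /= invgK.
have [y [Xy Vy y1 [_ yg]]] := np_reduce HV' Vg' Xx x1 xg.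
apply: y1; apply: invg_inj; rewrite invg1.
rewrite /iv /= in Xy Vy; have Ng := np_norm HV Vg.
have : y^-1 ^ g^-1 = 1.
  apply: rg; first exact: norm_memV.
  split; first by apply: XM; apply: norm_memV.
  by move: yg; rewrite /iv /=; gsimp.
by move/(congr1 (fun t => t ^ g)); rewrite conjgKV conj1g.
Qed.

End OneSide.

Section TwoSided.
Variables (M X V : set A) (w d : A).
Hypotheses (HV : normalizing_part M X V)
  (HV' : normalizing_part (iv M) (iv X) (iv V)).
Let HM := np_noeth HV.
Let cX := np_closed HV.
Let XM : X `<=` M := cl_le cX.
Let VM : V `<=` M := np_le HV.
Let U := reduced_part M X V.

Lemma iv_reduced_part : iv U = reduced_part (iv M) (iv X) (iv V).
Proof.
apply/seteqP; split=> g [Vg rg]; split=> //.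
  by rewrite -[g]invgK; apply: reduced_mirror HV _ HV' Vg rg.
have := reduced_mirror HV' _ Vg rg; rewrite !ivK; exact.
Qed.

Lemma reduced_part_closed : closed V U.
Proof.
split.
- by move=> g [].
- exact: reduced_part_sub HV.
- exact: reduced_part_fc HV.
- exact: reduced_part_join HV.
- by rewrite iv_reduced_part; apply: reduced_part_join HV'.
Qed.

(** With [n = d^-1 * w], also [w = n * d ^ n]. An [x] in [X] dividing [n] makes [d * x] a divisor of
    [w] in [X], so [n] is reduced. It is maximal, because a reduced divisor [u] of [w] gives [d * u]
    dividing [w]. *)
Lemma reduced_part_parab : V w -> V d -> X d -> dv M d w ->
  (forall x, X x -> dv M x w -> dv M x d) -> parab V w U (d^-1 * w).
Proof.
move=> Vw Vd Xd [Md dw] dmax; have [V1 VV] := np_sub HV.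
have Vn : V (d^-1 * w) by apply: np_div HV _ _ Vd Vw dw.
have rn : reduced M X (d^-1 * w).
  move=> x Xx xn; have : dv M (d * x) d.
    apply: dmax; first exact: (cl_sub cX).2.
    by have := dv_mul2l HM Md xn; rewrite mulVKg.
  case=> _; rewrite invgM mulgVK => Mx.
  exact: noeth_unit HM _ (XM Xx) Mx.
split; first exact: reduced_part_closed.
- by [].
- split=> //; apply: (np_div HV) => //.
  have -> : (d^-1 * w)^-1 * w = d ^ (d^-1 * w) by gsimp.
  by apply: XM; apply: norm_mem Xd; apply: np_norm HV _ Vn.
- move=> u [Vu ru] [_ uw].
  have duw : dv M d (u * (u^-1 * w)) by rewrite mulVKg.
  have [_] := reduced_dv_mull HV Vu ru Xd (VM uw) duw.
  rewrite mulVKg => uw'; split=> //; apply: (np_div HV) => //.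
  by move: uw'; gsimp.
Qed.

(** An atom of [V] that is not reduced has a nontrivial divisor in both [X] and [V], hence equals it
    and lies in [X]. Conversely the factors in [V] of a reduced element are reduced, so none of its
    generators lies in [X]. *)
Lemma reduced_gen (T : set A) : V = gen_mon T :> set A ->
  (forall n, T n -> atom V n) -> U = gen_mon (T `\` X) :> set A.
Proof.
move=> VT Tat; have [V1 VV] := np_sub HV.
apply/seteqP; split; last first.
  apply: gen_mon_le; first exact: reduced_part_sub HV.
  move=> n [Tn nX]; have [Vn n1 Hn] := Tat n Tn; split=> // x Xx xn.
  apply: contrapT => x1; have [y [Xy Vy y1 yn]] := np_reduce HV Vn Xx x1 xn.
  have Vyn : V (y^-1 * n) by apply: np_div HV _ _ Vy Vn yn.2.
  have [//|E] := Hn y (y^-1 * n) Vy Vyn (mulVKg _ _).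
  by apply: nX; rewrite -[n](mulVKg y) E mulg1.
move=> g; elim/(noeth_ind HM): g => g IH [Vg rg].
have : subm_set (gen_mon T) g by rewrite -VT.
move=> /gen_mon_split [->|[n [h [Tn Gh E]]]]; first exact: (submP (gen_mon _)).1.
have [Vn n1 _] := Tat n Tn; have Vh : V h by rewrite VT.
have rnh : reduced M X (n * h) by rewrite -E.
have rn := reduced_left HV (VM Vh) rnh.
rewrite E; apply: (submP (gen_mon _)).2.
  apply: gen_mon_mem; split=> // Xn; apply: n1; apply: rn => //.
  by apply: dv_refl HM _ _; exact: VM.
apply: IH; last by split=> //; apply: reduced_right HV _ _ Vn (VM Vh) rnh.
split; first exact: VM.
  by exists n; [exact: VM | exists 1; [exact: (noeth_sub HM).1 | rewrite mulg1]].
by move=> hg; apply: n1; apply: (mulIg h); rewrite mul1g -E.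
Qed.

End TwoSided.

Lemma quasi_centralizerE (X : submonoid A) g :
  quasi_centralizer X g <-> subm_set (gen_grp X) g /\ norm X g.
Proof.
split=> -[Gg H]; split=> //.
  apply: normP => x Xx.
    have : [set x * g | x in X] (x * g) by exists x.
    by rewrite -H => -[y Xy E]; rewrite conjgE -E mulKg.
  have : [set g * x | x in X] (g * x) by exists x.
  by rewrite H => -[y Xy E]; rewrite conjgE invgK mulgA -E mulgK.
apply/seteqP; split=> _ [x Xx <-].
  by exists (x ^ g^-1); [exact: norm_memV | gsimp].
by exists (x ^ g); [exact: norm_mem | gsimp].
Qed.

Lemma gen_grp_conj (X : submonoid A) n g : norm X g ->
  subm_set (gen_grp X) n -> subm_set (gen_grp X) (n ^ g).
Proof.
move=> Ng; have [[G1 GG] GV] := gen_grp_subgroup X.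
apply: (@gen_grp_le _ X [set n | subm_set (gen_grp X) (n ^ g)]).
  split; first split=> /=; first by rewrite conj1g.
  - by move=> a b; rewrite conjMg; apply: GG.
  - by move=> a; rewrite /= conjVg; apply: GV.
by move=> x Xx; apply: gen_grp_mem; apply: norm_mem.
Qed.

Lemma norm_pow (X : set A) d k : norm X d -> norm X (d ^+ k).
Proof.
by move=> Nd; elim: k => [|k IH]; rewrite ?expg0 ?expgS; [exact: norm1 | exact: normM].
Qed.

(** The denominator can be chosen to be a power of [d], which normalizes [X]; hence if [g]
    normalizes [X], so does the numerator [a]. This places the quasi-centralizer in the group
    generated by the shakers. *)
Lemma gen_grp_pow (X : submonoid A) d g : garside X d ->
  subm_set (gen_grp X) g -> exists k a, subm_set X a /\ g * d ^+ k = a.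
Proof.
move=> HX; have Nd : norm X d.
  by apply: normP; [exact: ga_conj HX | exact: ga_conjV HX].
have [X1 XX] := submP X; have Xd := ga_mem HX.
have Xdk k : subm_set X (d ^+ k).
  by elim: k => [|k IH]; rewrite ?expg0 ?expgS //; apply: XX.
move=> Gg; suff [k Hk] : exists k, subm_set X (g * d ^+ k) by exists k, (g * d ^+ k).
have [c [e [Xc Xe ->]]] := gen_grp_frac (submP X) (fun y Xy => Xy) (joins_ore (ga_jl HX)) Gg.
have [k [_ ek]] := garside_pow HX Xe.
by exists k; rewrite -mulgA; apply: XX.
Qed.

Section Semidirect.
Variables (M V : set A) (X : submonoid A) (d : A) (T : set A).
Hypotheses (HV : normalizing_part M X V) (HX : garside X d) (Vd : V d)
  (XV : forall g, subm_set X g -> norm X g -> V g)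
  (VT : V = gen_mon T :> set A)
  (UT : reduced_part M X V = gen_mon (T `\` X) :> set A)
  (JU : has_joins (reduced_part M X V)).
Let HM := np_noeth HV.
Let XM : X `<=` M := cl_le (np_closed HV).

Lemma norm_gen_grp g : subm_set (gen_grp T) g -> norm X g.
Proof.
apply: (@gen_grp_le _ T [set g | norm X g]).
  by split; [split; [exact: norm1 | exact: normM] | exact: normV].
by move=> n /gen_mon_mem; rewrite -VT; exact: (np_norm HV).
Qed.

Lemma semidirect_part : is_semidirect_product (gen_grp T)
  (quasi_centralizer X) (gen_grp (T `\` X)).
Proof.
have [[G1 GG] GV] := gen_grp_subgroup T.
have [[X1 XX] XVg] := gen_grp_subgroup X.
have Nsub : is_subgroup (quasi_centralizer X).
  split; first split.
  - by apply/quasi_centralizerE; split=> //; exact: norm1.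
  - move=> a b /quasi_centralizerE [Ga Na] /quasi_centralizerE [Gb Nb].
    by apply/quasi_centralizerE; split; [exact: XX | exact: normM].
  - move=> a /quasi_centralizerE [Ga Na].
    by apply/quasi_centralizerE; split; [exact: XVg | exact: normV].
have Ksub := gen_grp_subgroup (T `\` X).
have KG : gen_grp (T `\` X) `<=` gen_grp T.
  apply: gen_grp_le; first exact: gen_grp_subgroup.
  by move=> n [Tn _]; apply: gen_grp_mem.
have VG g : V g -> subm_set (gen_grp T) g by rewrite VT; apply: gen_mon_grp.
have NG : quasi_centralizer X `<=` gen_grp T.
  move=> n /quasi_centralizerE [Gn Nn].
  have [k [a [Xa E]]] := gen_grp_pow HX Gn.
  have Nd : norm X d by apply: np_norm HV _ Vd.
  have Ga : subm_set (gen_grp T) a.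
    by apply: VG; apply: XV => //; rewrite -E; apply: normM => //; exact: norm_pow.
  have -> : n = a * (d ^+ k)^-1 by rewrite -E mulgK.
  apply: (GG) => //; apply: GV; elim: {E} k => [|k IH]; first by rewrite expg0.
  by rewrite expgS; apply: GG => //; exact: VG.
have Nnorm n g : quasi_centralizer X n -> subm_set (gen_grp T) g ->
    quasi_centralizer X (n ^ g).
  move=> /quasi_centralizerE [Gn Nn] Gg; have Ng := norm_gen_grp Gg.
  apply/quasi_centralizerE; split; first exact: gen_grp_conj.
  by rewrite conjgE; apply: normM; [exact: normV | exact: normM].
split=> //.
- apply/seteqP; split=> [n [/quasi_centralizerE [Gn Nn] Kn]|_ ->]; last first.
    by split; [exact: Nsub.1.1 | exact: Ksub.1.1].
  (* [n = e^-1 * c] on the side of [X] and [n = a * b^-1] on the side of the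
     reduced elements, so that [c * b = e * a] has maximal [X]-divisor both [c]
     and [e]. *)
  have [c [e [Xc Xe nE]]] : exists c e, [/\ subm_set X c, subm_set X e & n = e^-1 * c].
    have HXi := garside_iv HX.
    have Gn' : subm_set (gen_grp (iv X)) n.
      move: Gn; apply: gen_grp_le; first exact: gen_grp_subgroup.
      move=> x Xx; rewrite -[x]invgK; apply: (gen_grp_subgroup (iv X)).2.
      by apply: gen_grp_mem; rewrite /iv /= invgK.
    have [c [e [Xc Xe E]]] := gen_grp_frac (iv_sub (submP X)) (fun y Xy => Xy)
      (joins_ore (ga_jl HXi)) Gn'.
    by exists e^-1, c^-1; rewrite invgK.
  have [a [b [[Va ra] [Vb rb] nE']]] : exists a b,
      [/\ reduced_part M X V a, reduced_part M X V b & n = a * b^-1].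
    apply: gen_grp_frac Kn; first exact: reduced_part_sub HV.
      by rewrite UT; exact: gen_mon_mem.
    exact: joins_ore.
  have E : c * b = e * a.
    have : e * n * b = e * n * b by [].
    by rewrite {1}nE nE'; gsimp.
  have [Ma Mb] := (np_le HV Va, np_le HV Vb).
  have ce : dv M c e.
    by apply: (reduced_max HV ra) => //; rewrite -E; apply: dv_mulr => //; exact: XM.
  have ec : dv M e c.
    by apply: (reduced_max HV rb) => //; rewrite E; apply: dv_mulr => //; exact: XM.
  by rewrite /= nE (dv_anti HM ce ec) mulVg.
- apply/seteqP; split; last first.
    by move=> _ [n Nn [k Kk <-]]; apply: GG; [exact: NG | exact: KG].
  apply: gen_grp_le; last first.
    (* Each generator lies in one of the two factors: in the quasi-centralizer when it belongs to
       [X], in the other group when it does not. *)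
    move=> n Tn; have Vn : V n by rewrite VT; exact: gen_mon_mem.
    have [Xn|nX] := pselect (subm_set X n).
      exists n; last by exists 1; [exact: Ksub.1.1 | rewrite mulg1].
      by apply/quasi_centralizerE; split; [exact: gen_grp_mem | exact: np_norm HV _ Vn].
    exists 1; first exact: Nsub.1.1.
    by exists n; [exact: gen_grp_mem | rewrite mul1g].
  split; first split.
  + exists 1; first exact: Nsub.1.1.
    by exists 1; [exact: Ksub.1.1 | rewrite mulg1].
  + move=> _ _ [n Nn [k Kk <-]] [n' Nn' [k' Kk' <-]].
    exists (n * n' ^ k^-1).
      by apply: Nsub.1.2 => //; apply: Nnorm => //; apply: GV; exact: KG.
    by exists (k * k'); [exact: Ksub.1.2 | gsimp].
  + move=> _ [n Nn [k Kk <-]]; exists (n^-1 ^ k).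
      by apply: Nnorm; [exact: Nsub.2 | exact: KG].
    by exists k^-1; [exact: Ksub.2 | gsimp].
Qed.

End Semidirect.

End Reduced.

(** * Closure under factors from the lattice definition of parabolicity *)

Section Meets.
Variables (A : groupType) (M : set A).
Implicit Types (V : set A) (a b d g p q : A).

Lemma meet_ex a b : noeth M -> has_joins M -> M a -> M b ->
  exists m, is_meet (dv M) a b m.
Proof.
move=> HM J Ma Mb; pose L := [set c | dv M c a /\ dv M c b].
have [||c e [ca cb] [ea eb]|m [ma mb] Hm] := @directed_max _ M HM L a.
- by exists 1; split; apply: dv1.
- by move=> c [].
- have [m [cm [em H]]] := J c e ca.1 ea.1.
  by exists m; split=> //; split; apply: H.
by exists m; do 2!split=> //; move=> c ca cb; apply: Hm.
Qed.

(* Conjugation by [d ^+ k] turns [d ^+ k * q \in V] into [q * d ^+ k \in V],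
   which forces the left atoms of [q] into [V]. *)
Lemma parab_intro D V d : garside M D -> V `<=` M -> is_submonoid V ->
  join_closed M V -> join_closed (iv M) (iv V) ->
  (forall v, V v -> V (v ^ d)) -> (forall v, V v -> V (v ^ d^-1)) ->
  (forall g, dv M g d <-> dv M g D /\ V g) ->
  (forall p g, V p -> is_meet (dv M) D p g -> dv M g d) ->
  parab M D V d.
Proof.
move=> HG VM [V1 VV] jl jr Vc VcV dP meetP.
have HM := ga_noeth HG; have [M1 MM] := noeth_sub HM.
have MD := ga_mem HG.
have Md : M d by apply: (dv_mem HM) (((dP 1).2 _)); split=> //; exact: dv1.
have [dD Vd] := (dP d).1 (dv_refl HM Md).
(* An atom dividing [p] also divides [D], hence divides their meet, which divides [d]. *)
have atomP p s : V p -> atom M s -> dv M s p -> [/\ V s, V (s^-1 * d) & V (d * s^-1)].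
  move=> Vp As sp; have [m Hm] := meet_ex HM (ga_jl HG) MD (VM _ Vp).
  have sd : dv M s d.
    apply: (dv_trans HM) (meetP p m Vp Hm); apply: Hm.2.2 => //.
    exact: ga_atom HG _ As.
  have Vs : V s by have [] := (dP s).1 sd.
  have Vsd : V (s^-1 * d).
    apply: ((dP _).1 _).2; split; first exact: sd.2.
    have -> : (s^-1 * d)^-1 * d = s ^ d by gsimp.
    exact: VM (Vc _ Vs).
  split=> //; have -> : d * s^-1 = (s^-1 * d) ^ d^-1 by gsimp.
  exact: VcV.
have Vck k v : V v -> V (v ^ (d ^+ k)) /\ V (v ^ (d ^+ k)^-1).
  elim: k v => [|k IH] v Vv; first by rewrite expg0 invg1 !conjg1.
  split; first by rewrite expgSr conjgM; apply: Vc; apply: (IH v Vv).1.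
  by rewrite expgS invgM conjgM; apply: VcV; apply: (IH v Vv).2.
have key q k : M q -> V (d ^+ k * q) -> V q.
  move=> Mq; elim/(atom_ind HM): q / Mq k => // s q As Mq IH k Vq.
  have Msq : M (s * q) by apply: MM => //; case: As.
  have [Ms _ _] := As.
  have [Vs _ Vds] : [/\ V s, V (s^-1 * d) & V (d * s^-1)].
    apply: (atomP (s * q * d ^+ k)) => //.
      by have := (Vck k _ Vq).1; gsimp.
    rewrite -mulgA; apply: dv_mulr => //; apply: (MM) => //.
    by elim: (k) => [|j IHj]; rewrite ?expg0 ?expgS //; apply: MM.
  (* Multiplying by the conjugate of [d * s^-1] under [(d ^+ k)^-1] trades the atom [s] for one more
     factor [d]. *)
  apply: (VV) => //; apply: (IH k.+1).
  have := VV _ _ (Vck k _ Vds).2 Vq.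
  by rewrite expgSr; gsimp.
have fc : factor_closed M V.
  move=> a b Ma; elim/(atom_ind HM): a / Ma b => [|s a As Ma IH] b Mb Vab.
    by rewrite mul1g in Vab.
  have [Ms _ _] := As.
  have [Vs _ Vds] : [/\ V s, V (s^-1 * d) & V (d * s^-1)].
    apply: atomP Vab As _; rewrite -mulgA; apply: dv_mulr => //; exact: MM.
  have [Va Vb] : V a /\ V b.
    (* The atom is removed by multiplying with [d * s^-1], which gives [d * (a * b)] in [V]; [key]
       then removes [d]. *)
    apply: IH => //; apply: (key _ 1%N); first exact: MM.
    by rewrite expg1; have := VV _ _ Vds Vab; gsimp.
  by split=> //; apply: (VV).
split=> //.
by move=> v Vv vD; apply/dP.
Qed.

End Meets.

(** * From one-object categories to submonoids and back *)

Section Transfer.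
Variables (T A : Type) (le : T -> T -> Prop) (r : A -> A -> Prop) (P : A -> Prop).
Variable f : T -> A.
Hypotheses (le_r : forall a b, le a b <-> r (f a) (f b))
  (fP : forall g, P g -> exists t, f t = g)
  (rP : forall a b, r a b -> P a /\ P b) .

Lemma join_transfer a b m : is_join le a b m <-> is_join r (f a) (f b) (f m).
Proof.
split=> -[/le_r am [/le_r bm H]]; split=> //; split=> // c.
  move=> ac bc; have [_ /fP [t E]] := rP ac; rewrite -E in ac bc *.
  by apply/le_r; apply: H; apply/le_r.
by move=> /le_r ac /le_r bc; apply/le_r; apply: H.
Qed.

Lemma meet_transfer a b m : is_meet le a b m <-> is_meet r (f a) (f b) (f m).
Proof.
split=> -[/le_r am [/le_r bm H]]; split=> //; split=> // c.
  move=> ac bc; have [/fP [t E] _] := rP ac; rewrite -E in ac bc *.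
  by apply/le_r; apply: H; apply/le_r.
by move=> /le_r ac /le_r bc; apply/le_r; apply: H.
Qed.

End Transfer.

Section MonCat.
Variables (A : groupType) (U : submonoid A).
Implicit Types (V : submonoid A).

Lemma is_idP (x y : ob (mon_cat U)) (f : hom x y) : is_id f <-> sval f = 1.
Proof.
split; first by case.
case: x f; case: y => f E.
by have -> : f = @idm (mon_cat U) tt; [apply: sval_eq | constructor].
Qed.

Lemma is_atomP (x y : ob (mon_cat U)) (f : hom x y) : is_atom f <-> atom U (sval f).
Proof.
split=> [[nid H]|[_ f1 H]].
  split; first exact: proj2_sig.
    by move=> E; apply: nid; apply/is_idP.
  move=> a b Ua Ub ab.
  have [|/is_idP|/is_idP] := H tt (exist _ a Ua) (exist _ b Ub); [|by left|by right].
  exact: sval_eq.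
split; first by move/is_idP.
move=> z a b ab; have := H (sval a) (sval b) (proj2_sig a) (proj2_sig b).
by rewrite -ab => /(_ erefl) [E|E]; [left|right]; apply/is_idP.
Qed.

Definition oval (f : @outm (mon_cat U) tt) : A := sval (projT2 f).
Definition ival (f : @inm (mon_cat U) tt) : A := (sval (projT2 f))^-1.

Lemma oval_inj : injective oval.
Proof. by move=> [[] f] [[] g]; rewrite /oval /= => /sval_eq ->. Qed.

Lemma ival_inj : injective ival.
Proof. by move=> [[] f] [[] g]; rewrite /ival /= => /invg_inj /sval_eq ->. Qed.

Lemma oval_ex g : subm_set U g -> exists f, oval f = g.
Proof.
move=> Ug.
by exists (existT (fun y : ob (mon_cat U) => @hom (mon_cat U) tt y) tt (exist _ g Ug)).
Qed.

Lemma ival_ex g : iv U g -> exists f, ival f = g.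
Proof.
move=> Ug; exists (existT (fun y : ob (mon_cat U) => @hom (mon_cat U) y tt) tt (exist _ g^-1 Ug)).
by rewrite /ival invgK.
Qed.

Lemma left_divP (f g : @outm (mon_cat U) tt) : left_div f g <-> dv U (oval f) (oval g).
Proof.
case: f g => -[] f [[] g]; rewrite /left_div /oval /=; split=> [[u ->]|[Uf Ug]].
  by split; [exact: proj2_sig | rewrite /= mulKg; exact: proj2_sig].
by exists (exist _ _ Ug); apply: sval_eq; rewrite /= mulVKg.
Qed.

Lemma right_divP (f g : @inm (mon_cat U) tt) :
  right_div f g <-> dv (iv U) (ival f) (ival g).
Proof.
case: f g => -[] f [[] g]; rewrite /right_div /ival /dv /iv /= !invgK.
split=> [[u ->]|[Uf Ug]].
  split; first exact: proj2_sig.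
  by rewrite /= invgM !invgK mulgK; exact: proj2_sig.
by exists (exist _ _ Ug); apply: sval_eq; rewrite /= invgM !invgK mulgVK.
Qed.

Lemma dv_memP a b : dv U a b -> subm_set U a /\ subm_set U b.
Proof.
move=> [Ua Uab]; split=> //.
by rewrite -[b](mulVKg a); apply: (submP U).2.
Qed.

Lemma dv_iv_memP a b : dv (iv U) a b -> iv U a /\ iv U b.
Proof.
move=> [Ua Uab]; split=> //.
by rewrite -[b](mulVKg a); apply: (iv_sub (submP U)).2.
Qed.

Definition joinl_transfer := join_transfer left_divP oval_ex dv_memP.
Definition meetl_transfer := meet_transfer left_divP oval_ex dv_memP.
Definition joinr_transfer := join_transfer right_divP ival_ex dv_iv_memP.
Definition meetr_transfer := meet_transfer right_divP ival_ex dv_iv_memP.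

(** By dependent choice a counterexample to the induction principle yields an infinite chain of
    proper factors. *)
Lemma noetherian_noeth : noetherian (mon_cat U) -> noeth U.
Proof.
move=> Hn; split; first exact: submP.
move=> P IH b; apply: contrapT => Pb.
have next (x : {x | ~ P x}) : exists y : {x | ~ P x}, proper_factor U (sval y) (sval x).
  case: x => x Px; apply: contrapT => H; apply: (Px); apply: IH => a ax.
  by apply: contrapT => Pa; apply: H; exists (exist _ a Pa).
have [F HF] := choice next.
pose x n := iter n F (exist _ b Pb).
have Ux n : subm_set U (sval (x n)).
  have [Uy [u Uu [v Uv -> _]]] := HF (x n).
  by apply: (submP U).2 => //; apply: (submP U).2.
pose a n := @Arrow (mon_cat U) tt tt (exist _ (sval (x n)) (Ux n)).
have [|N /(_ N.+1 (leqnSn N))] := Hn a.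
  move=> n; have [_ [u Uu [v Uv E _]]] := HF (x n).
  by exists (exist _ u Uu), (exist _ v Uv); apply: sval_eq.
have [_ _ ne] := HF (x N).
move=> E; have {}E : sval (x N.+1) = sval (x N).
  exact: (congr1 (fun ar : arrow (mon_cat U) => sval (mor ar)) E).
have [_ [_ _ [_ _ _]]] := HF (x N); exact.
Qed.

Lemma is_garside_garside (D : garside_data (mon_cat U)) : is_garside D ->
  garside U (sval (gDelta D tt)).
Proof.
move=> HD; have [[/noetherian_noeth Hn _] _ _ Hl Ha] := HD; split=> //.
- exact: proj2_sig.
- exact: conj_Delta_mem HD.
- exact: conj_DeltaV_mem HD.
- move=> a b /oval_ex [f <-] /oval_ex [g <-].
  have [[_ _ _ J _] _] := Hl tt; have [m Hm] := J f g.
  by exists (oval m); apply/joinl_transfer.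
- move=> a b /ival_ex [f <-] /ival_ex [g <-].
  have [_ [_ _ _ J _]] := Hl tt; have [m Hm] := J f g.
  by exists (ival m); apply/joinr_transfer.
- move=> s As; have [Us _ _] := As.
  have [|v' [/(congr1 sval) /= E _]] := Ha tt tt (exist _ s Us); first exact/is_atomP.
  by split=> //; rewrite -E mulKg; exact: proj2_sig.
Qed.

Lemma garside_is_garside d : garside U d ->
  exists2 GD : garside_data (mon_cat U), is_garside GD & forall x, sval (gDelta GD x) = d.
Proof.
move=> HG; have HM := ga_noeth HG.
pose cj (e : A) (H : forall g, subm_set U g -> subm_set U (g ^ e))
  (f : {g | subm_set U g}) : {g | subm_set U g} := exist _ (sval f ^ e) (H _ (proj2_sig f)).
have cj1 (x : ob (mon_cat U)) : cj d (ga_conj HG) (idm x) = idm x.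
  by apply: sval_eq; rewrite /= conj1g.
have cjM (x y z : ob (mon_cat U)) (f : hom x y) (g : hom y z) :
    cj d (ga_conj HG) (f ∘> g) =
    (cj d (ga_conj HG) f : hom x y) ∘> (cj d (ga_conj HG) g : hom y z).
  by apply: sval_eq; rewrite /= conjMg.
pose F := @Functor (mon_cat U) (mon_cat U) id (fun _ _ f => cj d (ga_conj HG) f) cj1 cjM.
pose GD := @GarsideData (mon_cat U) F (fun _ => exist _ d (ga_mem HG)).
exists GD => //; split.
- split.
    move=> f Hf.
    pose c n := sval (mor (f n)).
    have [N HN] : exists N, forall n, (N <= n)%N -> c n = c N.
      (* Induction on the value of a term: a later term with a different value is a proper factor of
         it. *)
      suff H x : forall N, c N = x -> exists N, forall n, (N <= n)%N -> c n = c N.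
        exact: H (c 0%N) 0%N erefl.
      elim/(noeth_ind HM): x => x IH N E.
      have [//|nc] := pselect (forall n, (N <= n)%N -> c n = c N); first by exists N.
      have [n [Nn ne]] : exists n, (N <= n)%N /\ c n <> c N.
        apply: contrapT => H; apply: nc => n Nn; apply: contrapT => ne.
        by apply: H; exists n.
      apply: (IH (c n)) (erefl); split; first exact: proj2_sig.
        rewrite -E; elim: n Nn {ne} => [|n IHn].
          rewrite leqn0 => /eqP ->.
          by exists 1; [exact: (submP U).1 | exists 1; [exact: (submP U).1 | gsimp]].
        rewrite leq_eqVlt => /orP [/eqP ->|].
          by exists 1; [exact: (submP U).1 | exists 1; [exact: (submP U).1 | gsimp]].
        move=> /IHn [u Uu [v Uv ->]]; have [w1 [w2 /(congr1 sval) /= Ew]] := Hf n.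
        exists (u * sval w1); first by apply: (submP U).2 => //; exact: proj2_sig.
        exists (sval w2 * v); first by apply: (submP U).2 => //; exact: proj2_sig.
        by rewrite {1}/c Ew; gsimp.
      by rewrite -E.
    exists N => n /HN; rewrite /c; case: (f n) => -[] [] a; case: (f N) => -[] [] b /=.
    by move=> /sval_eq ->.
  split=> x y z f g h /(congr1 sval) /= E; apply: sval_eq.
    exact: mulgI E.
  exact: mulIg E.
- split; first by exists id.
  move=> x y; exists (cj d^-1 (ga_conjV HG)) => f; apply: sval_eq => /=.
    by rewrite conjgK.
  by rewrite conjgKV.
- by move=> x y v; apply: sval_eq; rewrite /= -conjgC.
- have HMi := iv_noeth HM.
  move=> []; split; split.
  + by move=> a; apply/left_divP/(dv_refl HM); exact: proj2_sig.
  + by move=> a b /left_divP ab /left_divP ba; apply/oval_inj/(dv_anti HM).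
  + by move=> a b c /left_divP ab /left_divP bc; apply/left_divP/(dv_trans HM ab).
  + move=> a b; have [m Hm] := ga_jl HG (proj2_sig (projT2 a)) (proj2_sig (projT2 b)).
    have [_ /oval_ex [f E]] := dv_memP Hm.1.
    by exists f; apply/joinl_transfer; rewrite E.
  + move=> a b; have [m Hm] := meet_ex HM (ga_jl HG) (proj2_sig (projT2 a)) (proj2_sig (projT2 b)).
    have [/oval_ex [f E] _] := dv_memP Hm.1.
    by exists f; apply/meetl_transfer; rewrite E.
  + move=> a; apply/right_divP/(dv_refl HMi); rewrite /iv /ival /= invgK; exact: proj2_sig.
  + by move=> a b /right_divP ab /right_divP ba; apply/ival_inj/(dv_anti HMi).
  + by move=> a b c /right_divP ab /right_divP bc; apply/right_divP/(dv_trans HMi ab).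
  + have Ui (a : @inm (mon_cat U) tt) : iv U (ival a).
      by rewrite /iv /ival /= invgK; exact: proj2_sig.
    move=> a b; have [m Hm] := ga_jr HG (Ui a) (Ui b).
    have [_ /ival_ex [f E]] := dv_iv_memP Hm.1.
    by exists f; apply/joinr_transfer; rewrite E.
  + have Ui (a : @inm (mon_cat U) tt) : iv U (ival a).
      by rewrite /iv /ival /= invgK; exact: proj2_sig.
    move=> a b; have [m Hm] := meet_ex HMi (ga_jr HG) (Ui a) (Ui b).
    have [/ival_ex [f E] _] := dv_iv_memP Hm.1.
    by exists f; apply/meetr_transfer; rewrite E.
- move=> x y v /is_atomP /(ga_atom HG) [Uv Uvd].
  exists (exist _ _ Uvd); split; apply: sval_eq; rewrite /= ?mulVKg //.
  by gsimp.
Qed.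

Section ParabolicMon.
Variables (D : garside_data (mon_cat U)) (HD : is_garside D) (V : submonoid A) (d : A).
Let Delta := sval (gDelta D tt).

Lemma parabolic_parab : parabolic_submonoid D V d -> parab U Delta V d.
Proof.
move=> [VU [Q [Hlat [_ Hbij] Hnat Hdiv] Qe]].
pose o : ob (sub_cat (mon_sub U V)) := exist _ tt I.
(* Naturality forces the automorphism to be conjugation by [d]. *)
have phiE (v : @hom (sub_cat (mon_sub U V)) o o) :
    sval (sval (fhom (pphi Q) v)) = sval (sval v) ^ d.
  have /(congr1 sval) /= := Hnat o o v; rewrite !Qe => H.
  by rewrite conjgE -H mulKg.
have [H1 H2] := Hdiv o.
have dP f : left_div f (outm_of (pdelta Q o)) <->
    left_div f (outm_of (gDelta D tt)) /\ @sub_out (mon_cat U) (mon_sub U V) tt f.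
  by rewrite -[left_div f _]/([set f | left_div f (outm_of (pdelta Q o))] f) H1.
have mP f : left_div f (outm_of (pdelta Q o)) <->
    exists2 p, @sub_out (mon_cat U) (mon_sub U V) tt p &
      is_meet (@left_div (mon_cat U) tt) (outm_of (gDelta D tt)) p f.
  by rewrite -[left_div f _]/([set f | left_div f (outm_of (pdelta Q o))] f) H2.
have oE : oval (outm_of (pdelta Q o)) = d by rewrite /oval /= Qe.
have HG := is_garside_garside HD; have HM := ga_noeth HG.
have [Hl Hr] := Hlat tt I.
apply: (parab_intro HG VU (submP V)).
- move=> a b m Va Vb Hm.
  have [f Ef] := oval_ex (VU _ Va); have [g Eg] := oval_ex (VU _ Vb).
  have Pf : @sub_out (mon_cat U) (mon_sub U V) tt f by rewrite /sub_out /= -/(oval f) Ef.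
  have Pg : @sub_out (mon_cat U) (mon_sub U V) tt g by rewrite /sub_out /= -/(oval g) Eg.
  have [[n /joinl_transfer]] := Hl _ _ Pf Pg; rewrite Ef Eg => Hn Vn _.
  by rewrite (join_uniq HM Hm Hn).
- move=> a b m Va Vb Hm.
  have [f Ef] := ival_ex (VU _ Va : iv U a); have [g Eg] := ival_ex (VU _ Vb : iv U b).
  have valE h : sval (projT2 h) = (ival h)^-1 by rewrite /ival invgK.
  have Pf : @sub_in (mon_cat U) (mon_sub U V) tt f by rewrite /sub_in /= valE Ef.
  have Pg : @sub_in (mon_cat U) (mon_sub U V) tt g by rewrite /sub_in /= valE Eg.
  have [[n /joinr_transfer]] := Hr _ _ Pf Pg; rewrite Ef Eg => Hn Vn _.
  by rewrite (join_uniq (iv_noeth HM) Hm Hn) /iv /= -valE.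
- move=> v Vv; pose f : @hom (sub_cat (mon_sub U V)) o o := exist _ (exist _ v (VU _ Vv)) Vv.
  by rewrite -[v]/(sval (sval f)) -phiE; apply: (proj2_sig (fhom (pphi Q) f)).
- move=> v Vv; have [h _ hK] := Hbij o o.
  pose f : @hom (sub_cat (mon_sub U V)) (fob (pphi Q) o) (fob (pphi Q) o) :=
    exist _ (exist _ v (VU _ Vv)) Vv.
  have /(congr1 (fun z => sval (sval z))) := hK f; rewrite phiE /= => <-.
  by rewrite conjgK; apply: (proj2_sig (h f)).
- move=> g; split.
    move=> gd; have [f Ef] := oval_ex gd.1.
    have /dP [/left_divP fD Vf] : left_div f (outm_of (pdelta Q o)).
      by apply/left_divP; rewrite oE Ef.
    by rewrite -Ef.
  move=> [gD Vg]; have [f Ef] := oval_ex gD.1.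
  have : left_div f (outm_of (pdelta Q o)).
    apply/dP; split; first by apply/left_divP; rewrite Ef.
    by rewrite /sub_out /= -/(oval f) Ef.
  by move/left_divP; rewrite oE Ef.
- move=> p g Vp Hm; have [f Ef] := oval_ex (VU _ Vp); have [h Eh] := oval_ex Hm.1.1.
  have : left_div h (outm_of (pdelta Q o)).
    apply/mP; exists f; first by rewrite /sub_out /= -/(oval f) Ef.
    by apply/meetl_transfer; rewrite Ef Eh.
  by move/left_divP; rewrite oE Eh.
Qed.

Lemma parab_parabolic : parab U Delta V d ->
  exists2 Q : parabolic_data (mon_sub U V),
    is_parabolic D Q & forall x, sval (pdelta Q x) = d.
Proof.
move=> HP; have HG := is_garside_garside HD; have HM := ga_noeth HG.
have [clV Vd dD dmax] := HP; have VU := cl_le clV.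
pose act b (H : forall g, subm_set V g -> subm_set V (g ^ b))
    (f : {f : {g | subm_set U g} | subm_set V (sval f)}) :
    {f : {g | subm_set U g} | subm_set V (sval f)} :=
  exist _ (exist _ (sval (sval f) ^ b) (VU _ (H _ (proj2_sig f))))
    (H _ (proj2_sig f)).
have Vc g (Vg : subm_set V g) := (parab_conj HG HP Vg).1.
have VcV g (Vg : subm_set V g) := (parab_conj HG HP Vg).2.
have act1 : forall x : ob (sub_cat (mon_sub U V)), act d Vc (idm x) = idm x.
  by move=> x; do 2!apply: sval_eq; rewrite /= conj1g.
have actM : forall (x y z : ob (sub_cat (mon_sub U V)))
      (f : hom x y) (g : hom y z),
    act d Vc (f ∘> g) = (act d Vc f : hom x y) ∘> (act d Vc g : hom y z).
  by move=> x y z f g; do 2!apply: sval_eq; rewrite /= conjMg.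
pose F : functor (sub_cat (mon_sub U V)) (sub_cat (mon_sub U V)) :=
  @Functor (sub_cat (mon_sub U V)) (sub_cat (mon_sub U V)) id
    (fun _ _ f => act d Vc f) act1 actM.
exists (@ParabolicData _ (mon_sub U V) F (fun x => exist _ d (VU _ Vd))) => //.
have fcm a b : subm_set V b -> dv U a b -> subm_set V a.
  by move=> Vb ab; have [] := fc_dv VU (cl_fc clV) Vb ab.
split.
- move=> [] _; split=> f g Pf Pg.
    split.
      have [m Hm] := ga_jl HG (VU _ Pf) (VU _ Pg).
      have [_ /oval_ex [h E]] := dv_memP Hm.1.
      exists h; first by apply/joinl_transfer; rewrite E.
      by rewrite /sub_out /= -/(oval h) E; apply: (cl_jl clV) Hm.
    have [m Hm] := meet_ex HM (ga_jl HG) (VU _ Pf) (VU _ Pg).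
    have [/oval_ex [h E] _] := dv_memP Hm.1.
    exists h; first by apply/meetl_transfer; rewrite E.
    by rewrite /sub_out /= -/(oval h) E; apply: fcm Hm.1.
  have valE h : sval (projT2 h) = (ival h)^-1 by rewrite /ival invgK.
  rewrite /sub_in /= !valE in Pf Pg.
  split.
    have [m Hm] := ga_jr HG (VU _ Pf : iv U (ival f)) (VU _ Pg : iv U (ival g)).
    have [_ /ival_ex [h E]] := dv_iv_memP Hm.1.
    exists h; first by apply/joinr_transfer; rewrite E.
    by rewrite /sub_in /= valE E; apply: (cl_jr clV) Hm.
  have [m Hm] := meet_ex (iv_noeth HM) (ga_jr HG)
    (VU _ Pf : iv U (ival f)) (VU _ Pg : iv U (ival g)).
  have [/ival_ex [h E] _] := dv_iv_memP Hm.1.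
  exists h; first by apply/meetr_transfer; rewrite E.
  rewrite /sub_in /= valE E.
  by have [] := @fc_dv _ (iv U) (iv V) m (ival f) (fun g => VU g^-1) (iv_fc (cl_fc clV)) Pf Hm.1.
- split; first by exists id.
  move=> x y; exists (act d^-1 VcV) => f; do 2!apply: sval_eq.
    by rewrite /= conjgK.
  by rewrite /= conjgKV.
- by move=> x y v; apply: sval_eq; rewrite /= -conjgC.
- move=> [[] []] delta Dl.
  have dE : oval delta = d by [].
  have DE : oval Dl = Delta by [].
  have divP f : left_div f delta <-> left_div f Dl /\ @sub_out (mon_cat U) (mon_sub U V) tt f.
    rewrite !left_divP dE DE; split=> [fd|[fD Vf]]; last exact: dmax.
    by split; [exact: (dv_trans HM fd dD) | exact: fcm fd].
  split; apply/seteqP; split=> f /=.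
  + by move/divP.
  + by move/divP.
  + move=> /divP [fD Vf]; exists f => //; split=> //; split=> //.
    by apply/left_divP/(dv_refl HM); exact: (VU).
  + move=> [p Vp [fD [fp _]]]; apply/divP; split=> //.
    by apply: fcm Vp _; move/left_divP: fp.
Qed.

End ParabolicMon.

Lemma atomsE : atoms U = atom U.
Proof.
apply/seteqP; split=> [_ [f [/is_atomP Af <-]] //|s As]; have [Us _ _] := As.
by exists (exist _ s Us); split=> //; apply/is_atomP.
Qed.

End MonCat.

(** * Groupoids of fractions and their universal property *)

Section FormalInverses.

Lemma functor_ext (C K : category) (f : ob C -> ob K)
    (h1 h2 : forall x y, hom x y -> hom (f x) (f y)) p1 q1 p2 q2 :
  (forall x y (g : hom x y), h1 x y g = h2 x y g) ->
  @Functor C K f h1 p1 q1 = @Functor C K f h2 p2 q2.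
Proof.
move=> H; have E : h1 = h2.
  by apply: functional_extensionality_dep => x; apply: functional_extensionality_dep => y;
     apply: functional_extensionality_dep => g; apply: H.
by subst h2; rewrite (Prop_irrelevance p1 p2) (Prop_irrelevance q1 q2).
Qed.

(** The type of a morphism map depends on the object map, so the values are compared after
    transport; over a common object map this transport is trivial by proof irrelevance. *)
Lemma fhom_eq (C K : category) (f : ob C -> ob K)
    (h1 h2 : forall x y, hom x y -> hom (f x) (f y)) p1 q1 p2 q2 :
  @Functor C K f h1 p1 q1 = @Functor C K f h2 p2 q2 ->
  forall x y (g : hom x y), h1 x y g = h2 x y g.
Proof.
move=> E x y g.
pose T (F : functor C K) (e : fob F = f) : hom (f x) (f y) :=
  eq_rect (fob F) (fun o : ob C -> ob K => hom (o x) (o y)) (fhom F g) f e.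
have H F F' (e : fob F = f) (e' : fob F' = f) : F = F' -> T F e = T F' e'.
  by move=> FF; subst F'; rewrite (Prop_irrelevance e e').
exact: H (@Functor C K f h1 p1 q1) (@Functor C K f h2 p2 q2) erefl erefl E.
Qed.

Lemma iso_cancel (K : category) (x y z : ob K) (k k' : hom x y) (f : hom y z) :
  is_groupoid K -> k ∘> f = k' ∘> f -> k = k'.
Proof.
move=> HK E; have [f' [ff' _]] := HK _ _ f.
by rewrite -[k]compm1 -ff' Defs.compA E -Defs.compA ff' compm1.
Qed.

(** The groupoid is given by its components over [ob C], so that [j] is the identity on objects and
    extending a functor along it requires no transport. *)
Variables (C : category) (h : ob C -> ob C -> Type) (i : forall x, h x x)
  (c : forall x y z, h x y -> h y z -> h x z)
  (e1 : forall x y (f : h x y), c (i x) f = f)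
  (e2 : forall x y (f : h x y), c f (i y) = f)
  (e3 : forall x y z t (f : h x y) (g : h y z) (k : h z t),
    c f (c g k) = c (c f g) k).
Let G := @Category (ob C) h i c e1 e2 e3.
Variables (fh : forall x y, @hom C x y -> h x y)
  (p1 : forall x, fh (idm x) = i x)
  (p2 : forall x y z (f : @hom C x y) (g : hom y z), fh (f ∘> g) = c (fh f) (fh g)).
Let j := @Functor C G id fh p1 p2.

(* Every functor [F] to a groupoid extends by [a * b^-1 |-> F a * (F b)^-1]. *)
Lemma ore_formal_inverses :
  is_groupoid G ->
  (forall x y, injective (@fh x y)) ->
  (forall x y (g : h x y), exists z (a : hom x z) (b : hom y z), fh a = c g (fh b)) ->
  (forall x y z (a : @hom C x y) (b : hom x z),
    exists t (u : hom y t) (v : hom z t), a ∘> u = b ∘> v) ->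
  is_formal_inverses j.
Proof.
move=> HG inj frac ore; split=> // K F HK.
(* The value at [g] is specified against all fractions representing [g], which makes it unique at
   once; existence is where independence of the fraction is shown. *)
pose ext x y (g : h x y) (k : hom (fob F x) (fob F y)) :=
  forall z (a : hom x z) (b : hom y z), fh a = c g (fh b) -> k ∘> fhom F b = fhom F a.
have ext_uniq x y (g : h x y) k k' : ext x y g k -> ext x y g k' -> k = k'.
  move=> Hk Hk'; have [z [a [b E]]] := frac _ _ g.
  by apply: (@iso_cancel K _ _ _ k k' (fhom F b) HK); rewrite (Hk _ _ _ E) (Hk' _ _ _ E).
have ext_ex x y (g : h x y) : exists k, ext x y g k.
  have [z [a [b E]]] := frac _ _ g; have [b' [bb' b'b]] := HK _ _ (fhom F b).
  exists (fhom F a ∘> b') => z1 a1 b1 E1.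
  (* Two fractions for [g] agree after their denominators are completed to a common multiple. *)
  have [t [u [v uv]]] := ore _ _ _ b b1.
  have auv : a ∘> u = a1 ∘> v.
    by apply: inj; rewrite !p2 E E1 -!e3 -!p2 uv.
  apply: (@iso_cancel K _ _ _ _ _ (fhom F v) HK).
  rewrite -Defs.compA -!fhomM -uv -auv !fhomM.
  by rewrite -!Defs.compA (Defs.compA b') b'b comp1m.
pose kk x y g := sval (cid (ext_ex x y g)).
have kkP x y g : ext x y g (kk x y g) by rewrite /kk; case: cid.
have kk1 x : kk x x (i x) = idm (fob F x).
  apply: ext_uniq (kkP _ _ _) _ => z a b; rewrite e1 => /inj ->.
  by rewrite comp1m.
have kkM x y z (f : h x y) (g : h y z) : kk x z (c f g) = kk x y f ∘> kk y z g.
  apply: ext_uniq (kkP _ _ _) _ => t a b E.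
  have [t1 [a1 [b1 E1]]] := frac _ _ g.
  (* With [b1 ∘> u = b ∘> v], the pair [a1 ∘> u], [b ∘> v] represents [g] and the pair [a ∘> v],
     [a1 ∘> u] represents [f]. *)
  have [s [u [v uv]]] := ore _ _ _ b1 b.
  apply: (@iso_cancel K _ _ _ _ _ (fhom F v) HK).
  have E2 : kk y z g ∘> fhom F (b ∘> v) = fhom F (a1 ∘> u).
    by apply: kkP; rewrite -uv !p2 E1 e3.
  have E3 : kk x y f ∘> fhom F (a1 ∘> u) = fhom F (a ∘> v).
    by apply: kkP; rewrite !p2 E E1 -!e3 -!p2 uv.
  by rewrite -!fhomM -E3 -E2 fhomM !Defs.compA.
pose F' := @Functor G K (fob F) kk kk1 kkM.
have kkj x y (f : @hom C x y) : kk x y (fh f) = fhom F f.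
  apply: ext_uniq (kkP _ _ _) _ => z a b; rewrite -p2 => /inj ->.
  by rewrite fhomM.
exists F'; split.
  clear -kkj; subst F'; destruct F as [fF hF q1 q2].
  by apply: functor_ext => x y g; rewrite /= kkj.
move=> [f2 h2 q1 q2] E.
have Ef : f2 = fob F by rewrite -E.
subst f2; apply: functor_ext => x y g /=.
symmetry; apply: ext_uniq (kkP _ _ _) => z a b Eab.
have E' : forall (x y : ob C) (f : @hom C x y), h2 x y (fh f) = fhom F f.
  clear -E; destruct F as [fF hF r1 r2] => /=.
  exact: (fhom_eq E).
rewrite -!E' Eab.
by rewrite (q2 x y z g (fh b)).
Qed.

End FormalInverses.

Section MonFormal.
Variable A : groupType.
Implicit Types U V G : submonoid A.

Definition fractions_of V G :=
  forall g, subm_set G g -> exists a b, [/\ subm_set V a, subm_set V b & g = a * b^-1].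

Definition ore_monoid V := forall a b, subm_set V a -> subm_set V b ->
  exists c e, [/\ subm_set V c, subm_set V e & a * c = b * e].

Lemma mon_incl_formal V G (VG : V `<=` G) : is_subgroup G ->
  fractions_of V G -> ore_monoid V -> is_formal_inverses (mon_incl VG).
Proof.
move=> [_ GV] frac ore; apply: ore_formal_inverses.
- move=> x y [g Gg]; exists (exist _ _ (GV _ Gg)).
  by split; apply: sval_eq; rewrite /= ?mulgV ?mulVg.
- by move=> x y f g /(congr1 sval) /= /sval_eq.
- move=> x y [g Gg]; have [a [b [Va Vb E]]] := frac g Gg.
  exists tt, (exist _ a Va), (exist _ b Vb); apply: sval_eq => /=.
  by rewrite E mulgVK.
- move=> x y z [a Va] [b Vb]; have [p [q [Vp Vq E]]] := ore a b Va Vb.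
  by exists tt, (exist _ p Vp), (exist _ q Vq); apply: sval_eq.
Qed.

Lemma mon_sub_formal U V U' G (UU' : U `<=` U') (VU : V `<=` U) (VG : V `<=` G)
    (GU' : G `<=` U') : is_subgroup G -> fractions_of V G -> ore_monoid V ->
  exists k : functor (sub_cat (mon_sub U V)) (sub_cat (mon_sub U' G)),
    functor_comp k (sub_incl (mon_sub U' G)) =
      functor_comp (sub_incl (mon_sub U V)) (mon_incl UU') /\ is_formal_inverses k.
Proof.
move=> [_ GV] frac ore.
pose kh (f : {f : {g | subm_set U g} | subm_set V (sval f)}) :
    {f : {g | subm_set U' g} | subm_set G (sval f)} :=
  exist _ (exist _ (sval (sval f)) (UU' _ (proj2_sig (sval f)))) (VG _ (proj2_sig f)).
have k1 (x : ob (sub_cat (mon_sub U V))) : kh (idm x) = @idm (sub_cat (mon_sub U' G)) x.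
  by do 2!apply: sval_eq.
have kM (x y z : ob (sub_cat (mon_sub U V))) (f : hom x y) (g : hom y z) :
    kh (f ∘> g) = (kh f : @hom (sub_cat (mon_sub U' G)) x y) ∘>
                  (kh g : @hom (sub_cat (mon_sub U' G)) y z).
  by do 2!apply: sval_eq.
exists (@Functor (sub_cat (mon_sub U V)) (sub_cat (mon_sub U' G)) id (fun _ _ f => kh f) k1 kM).
split; first by apply: functor_ext => x y f; apply: sval_eq.
apply: ore_formal_inverses.
- move=> x y [[g Ug] Gg].
  exists (exist _ (exist _ _ (GU' _ (GV _ Gg))) (GV _ Gg)).
  by split; do 2!apply: sval_eq; rewrite /= ?mulgV ?mulVg.
- by move=> x y f g /(congr1 (fun u => sval (sval u))) /= E; do 2!apply: sval_eq.
- move=> x y [[g Ug] Gg]; have [a [b [Va Vb E]]] := frac g Gg.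
  exists y, (exist _ (exist _ a (VU _ Va)) Va), (exist _ (exist _ b (VU _ Vb)) Vb).
  by do 2!apply: sval_eq; rewrite /= E mulgVK.
- move=> x y z [[a Ua] Va] [[b Ub] Vb]; have [p [q [Vp Vq E]]] := ore a b Va Vb.
  exists x, (exist _ (exist _ p (VU _ Vp)) Vp), (exist _ (exist _ q (VU _ Vq)) Vq).
  by do 2!apply: sval_eq.
Qed.

Section Loop.
Variables (Ap : submonoid A) (D : garside_data (mon_cat Ap)) (X : ribbon_ob D).

Lemma loop_hom_subproof (x y : ribbon_ob D) g :
  norm X g -> x = X -> y = X -> conj_set x g = y.
Proof. by move=> Ng -> ->. Qed.

Definition loop_hom (U V : submonoid A) (x y : ribbon_ob D) g (Ug : subm_set U g)
    (Vg : subm_set V g) (Ng : norm X g) (ex : x = X) (ey : y = X) :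
    {f : @hom (ribbon_cat D U) x y | shom (loop_sub U X V) f} :=
  exist _ (exist _ g (conj Ug (loop_hom_subproof Ng ex ey))) (And3 ex ey Vg).

Lemma loop_homE (U V : submonoid A) (x y : ob (sub_cat (loop_sub U X V)))
    (f : hom x y) : [/\ subm_set U (sval (sval f)), subm_set V (sval (sval f)),
      norm X (sval (sval f)), sval x = X & sval y = X].
Proof.
have aux (x' y' : ribbon_ob D) g : x' = X -> y' = X -> conj_set x' g = y' -> norm X g.
  by move=> -> ->.
case: f => [[g [Ug E]] [ex ey Vg]]; split=> //; exact: aux ex ey E.
Qed.

Lemma loop_eq (U V : submonoid A) (x y : ob (sub_cat (loop_sub U X V)))
    (f g : hom x y) : sval (sval f) = sval (sval g) -> f = g.
Proof. by move=> E; do 2!apply: sval_eq. Qed.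

Lemma loop_formal V G (VA : V `<=` Ap) (VG : V `<=` G)
    (GN : forall g, subm_set G g -> norm X g) :
  is_subgroup G -> fractions_of V G -> ore_monoid V ->
  exists k : functor (sub_cat (loop_sub Ap X V)) (sub_cat (loop_sub (full A) X G)),
    functor_comp k (sub_incl (loop_sub (full A) X G)) =
      functor_comp (sub_incl (loop_sub Ap X V)) (ribbon_incl D (@sub_full A Ap)) /\
    is_formal_inverses k.
Proof.
move=> [_ GV] frac ore.
pose C := sub_cat (loop_sub Ap X V); pose K := sub_cat (loop_sub (full A) X G).
pose mk (x y : ob K) g (Gg : subm_set G g) : @hom K x y :=
  @loop_hom (full A) G _ _ g I Gg (GN _ Gg) (proj2_sig x) (proj2_sig y).
pose mkV (x y : ob C) g (Vg : subm_set V g) : @hom C x y :=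
  @loop_hom Ap V _ _ g (VA _ Vg) Vg (GN _ (VG _ Vg)) (proj2_sig x) (proj2_sig y).
have memV (x y : ob C) (f : @hom C x y) : subm_set V (sval (sval f)).
  by have [] := loop_homE f.
have memG (x y : ob K) (f : @hom K x y) : subm_set G (sval (sval f)).
  by have [] := loop_homE f.
pose kh (x y : ob C) (f : @hom C x y) : @hom K x y := mk x y _ (VG _ (memV x y f)).
have k1 (x : ob C) : kh x x (idm x) = @idm K x by apply: loop_eq.
have kM (x y z : ob C) (f : @hom C x y) (g : @hom C y z) :
    kh x z (f ∘> g) = kh x y f ∘> kh y z g by apply: loop_eq.
exists (@Functor C K id kh k1 kM).
split; first by apply: functor_ext => x y f; apply: sval_eq.
apply: ore_formal_inverses.
- move=> x y f; exists (mk y x _ (GV _ (memG x y f))).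
  by split; apply: loop_eq; rewrite /= ?mulgV ?mulVg.
- by move=> x y f g /(congr1 (fun u => sval (sval u))) /= E; apply: loop_eq.
- move=> x y f; have [a [b [Va Vb E]]] := frac _ (memG x y f).
  exists y, (mkV x y _ Va), (mkV y y _ Vb).
  by apply: loop_eq; rewrite /= E mulgVK.
- move=> x y z a b; have [p [q [Vp Vq E]]] := ore _ _ (memV x y a) (memV x z b).
  exists x, (mkV y x _ Vp), (mkV z x _ Vq).
  by apply: loop_eq.
Qed.

End Loop.

End MonFormal.

(** * The ribbon category and its loops at one object *)

Section Ribbon.
Variables (A : groupType) (Ap : submonoid A) (D : garside_data (mon_cat Ap)).
Hypothesis HD : is_garside D.
Let Delta := sval (gDelta D tt).
Let HG : garside Ap Delta := is_garside_garside HD.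
Implicit Types (X Y : ribbon_ob D).

Lemma ribbon_ob_closed X : closed Ap X.
Proof. by have [d /(parabolic_parab HD) []] := rparab X. Qed.

Lemma closed_ribbon_ob (V : submonoid A) : closed Ap V ->
  exists Y : ribbon_ob D, rsubm Y = V.
Proof.
move=> cV; have [d Hd] := closed_max HG cV.
have PV : exists e, parabolic_submonoid D V e.
  by exists d; split; [exact: cl_le cV | exact: parab_parabolic].
by exists (RibbonOb PV).
Qed.

Lemma outP X g : out Ap X g <->
  subm_set Ap g /\ exists Y : ribbon_ob D, conj_set X g = Y.
Proof.
split=> [[Ug cY]|[Ug [Y XY]]]; split=> //; last first.
  by rewrite XY; exact: ribbon_ob_closed.
by have [Y EY] := @closed_ribbon_ob (conj_subm X g) cY; exists Y; rewrite EY.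
Qed.

(** Inverting a ribbon into [X] gives a mirror ribbon out of [X], whose target is the source of the
    original one. *)
Lemma in_outP X g : out (iv Ap) (iv X) g^-1 <->
  subm_set Ap g /\ exists Y : ribbon_ob D, conj_set Y g = X.
Proof.
split=> [[]|[Ug [Y YX]]]; rewrite /out -iv_conj.
  rewrite {1}/iv /= invgK => Ug /iv_closed; rewrite !ivK => cY; split=> //.
  have [Y EY] := @closed_ribbon_ob (conj_subm X g^-1) cY; exists Y.
  by rewrite EY /= conj_set_comp mulVg conj_set1.
split; first by rewrite /iv /= invgK.
apply: iv_closed; rewrite -YX conj_set_comp mulgV conj_set1.
exact: ribbon_ob_closed.
Qed.

Lemma ribbon_is_idP (x y : ob (ribbon_cat D Ap)) (f : hom x y) :
  is_id f <-> sval f = 1.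
Proof.
split; first by case.
case: f => g [Ug E] /= g1; subst g.
have xy : x = y by apply: ribbon_ob_eq; rewrite -E conj_set1.
by subst y; have -> : exist _ 1 (conj Ug E) = @idm (ribbon_cat D Ap) x;
  [apply: sval_eq | constructor].
Qed.

Definition rout X (f : @outm (ribbon_cat D Ap) X) : A := sval (projT2 f).
Definition rin X (f : @inm (ribbon_cat D Ap) X) : A := (sval (projT2 f))^-1.

Lemma rout_out X (f : @outm (ribbon_cat D Ap) X) : out Ap X (rout f).
Proof. by case: f => Y [g [Ug E]]; apply/outP; split=> //; exists Y. Qed.

Lemma rin_out X (f : @inm (ribbon_cat D Ap) X) : out (iv Ap) (iv X) (rin f).
Proof. by case: f => Y [g [Ug E]]; apply/in_outP; split=> //; exists Y. Qed.

Lemma rout_ex X g : out Ap X g -> exists f : @outm (ribbon_cat D Ap) X, rout f = g.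
Proof.
move=> /outP [Ug [Y E]].
by exists (existT (fun y : ob (ribbon_cat D Ap) => @hom (ribbon_cat D Ap) X y) Y
  (exist _ g (conj Ug E))).
Qed.

Lemma rin_ex X g : out (iv Ap) (iv X) g ->
  exists f : @inm (ribbon_cat D Ap) X, rin f = g.
Proof.
rewrite -[g]invgK => /in_outP [Ug [Y E]].
by exists (existT (fun y : ob (ribbon_cat D Ap) => @hom (ribbon_cat D Ap) y X) Y
  (exist _ g^-1 (conj Ug E))).
Qed.

(** Divisibility between ribbons from [X]. The quotient is automatically a ribbon, as it conjugates
    the target of [a] to that of [b]. *)
Definition odv M (X : set A) a b := [/\ out M X a, out M X b & dv M a b].

Lemma rout_divP X (f g : @outm (ribbon_cat D Ap) X) :
  left_div f g <-> odv Ap X (rout f) (rout g).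
Proof.
split=> [[u E]|[_ _ [_ H]]].
  split; try exact: rout_out.
  split; first by have [] := rout_out f.
  have E' : rout g = rout f * sval u by rewrite /rout E.
  by rewrite E' mulKg; exact: (proj2_sig u).1.
case: f g H => [Y [f [Uf Ef]]] [Z [g [Ug Eg]]]; rewrite /rout /= => H.
have E : conj_set Y (f^-1 * g) = Z by rewrite -Ef conj_set_comp mulVKg.
pose u : @hom (ribbon_cat D Ap) Y Z := exist _ (f^-1 * g) (conj H E).
by exists u; apply: sval_eq; rewrite /= mulVKg.
Qed.

Lemma rin_divP X (f g : @inm (ribbon_cat D Ap) X) :
  right_div f g <-> odv (iv Ap) (iv X) (rin f) (rin g).
Proof.
split=> [[u E]|[_ _ [_ H]]].
  split; try exact: rin_out.
  split; first by have [] := rin_out f.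
  have E' : rin g = rin f * (sval u)^-1 by rewrite /rin E /= invgM.
  by rewrite E' mulKg /iv /= invgK; exact: (proj2_sig u).1.
case: f g H => [Y [f [Uf Ef]]] [Z [g [Ug Eg]]].
rewrite /rin /iv /= invgM !invgK => H.
have E : conj_set Z (g * f^-1) = Y.
  by rewrite -conj_set_comp Eg -Ef conj_set_comp mulgV conj_set1.
pose u : @hom (ribbon_cat D Ap) Z Y := exist _ (g * f^-1) (conj H E).
by exists u; apply: sval_eq; rewrite /= mulgVK.
Qed.

Lemma odv_memP M (X : set A) a b : odv M X a b -> out M X a /\ out M X b.
Proof. by case. Qed.

Definition rjoinl_transfer X := join_transfer (@rout_divP X) (@rout_ex X) (@odv_memP Ap X).
Definition rmeetl_transfer X := meet_transfer (@rout_divP X) (@rout_ex X) (@odv_memP Ap X).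
Definition rjoinr_transfer X :=
  join_transfer (@rin_divP X) (@rin_ex X) (@odv_memP (iv Ap) (iv X)).
Definition rmeetr_transfer X :=
  meet_transfer (@rin_divP X) (@rin_ex X) (@odv_memP (iv Ap) (iv X)).

Section Nu.
Variables (N : nu_structure D) (X : ribbon_ob D).

Definition nu_rel s n := exists2 t : atom_type Ap, sval (sval t) = s & nu_val N X t = n.
Definition nut_rel s n :=
  exists2 t : atom_type Ap, sval (sval t) = s^-1 & nut_val N X t = n^-1.

Lemma atom_type_ex s : atom Ap s -> exists t : atom_type Ap, sval (sval t) = s.
Proof.
move=> As; have [Us _ _] := As.
have At : @is_atom (mon_cat Ap) tt tt (exist _ s Us) by apply/is_atomP.
by exists (exist _ _ At).
Qed.

Lemma nu_rel_system : nu_system Ap X nu_rel.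
Proof.
split.
- by move=> s /atom_type_ex [t E]; exists (nu_val N X t), t.
- move=> s _ [t _ <-]; split; first exact: (rout_out (nu N X t)).
  by move=> E; have [nid _] := nu_atom N X t; apply: nid; apply/ribbon_is_idP.
- move=> s _ f g [t _ <-] /outP [Uf [Y EY]] Ug E.
  have [_ H] := nu_atom N X t.
  have EZ : conj_set Y g = projT1 (nu N X t).
    by rewrite -EY conj_set_comp E; exact: (proj2_sig (projT2 (nu N X t))).2.
  have := H Y (exist _ f (conj Uf EY)) (exist _ g (conj Ug EZ)).
  case; first exact: sval_eq.
    by move=> /ribbon_is_idP; left.
  by move=> /ribbon_is_idP; right.
- move=> s _ g [t Es <-] /rout_ex [f <-] sf.
  rewrite -Es in sf; apply/(left_divP (fout (nu N X t)) (fout f)).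
  by apply: nu_div; apply/(left_divP (aout t) (fout f)).
- move=> s _ s' _ [t _ <-] [t' _ <-].
  have [g Hg] := nu_lcm N X t t'; exists (rout g); first exact: rout_out.
  by move/joinl_transfer: Hg.
Qed.

Lemma nut_rel_system : nu_system (iv Ap) (iv X) nut_rel.
Proof.
split.
- move=> s /iv_atomV /atom_type_ex [t E].
  by exists (nut_val N X t)^-1, t; rewrite ?invgK.
- move=> s n [t _ E]; rewrite -[n]invgK -E; split.
    exact: (rin_out (nut N X t)).
  move=> /(congr1 inv); rewrite invgK invg1 => E1.
  by have [nid _] := nut_atom N X t; apply: nid; apply/ribbon_is_idP.
- move=> s n f g [t _ En]; rewrite -{1}[f]invgK => /in_outP [Uf [Y EY]] Ug E.
  have [_ H] := nut_atom N X t.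
  have EZ : conj_set (projT1 (nut N X t)) g^-1 = Y.
    have EX := (proj2_sig (projT2 (nut N X t))).2.
    have EY' : conj_set X f = Y by rewrite -EY conj_set_comp mulVg conj_set1.
    rewrite -EY' -EX conj_set_comp -[sval _]/(nut_val N X t) En -E.
    by rewrite invgM mulgVK.
  have := H Y (exist _ g^-1 (conj Ug EZ)) (exist _ f^-1 (conj Uf EY)).
  case.
  + by apply: sval_eq; rewrite /= -invgM E -En.
  + by move=> /ribbon_is_idP /= /(congr1 inv); rewrite invgK invg1; right.
  + by move=> /ribbon_is_idP /= /(congr1 inv); rewrite invgK invg1; left.
- move=> s n g [t Es En] /rin_ex [f <-] sf.
  rewrite -[n]invgK -En.
  rewrite -[s]invgK -Es in sf; apply/(right_divP (fin (nut N X t)) (fin f)).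
  by apply: nut_div; apply/(right_divP (ain t) (fin f)).
- move=> s n s' n' [t _ En] [t' _ En'].
  have [g Hg] := nut_lcm N X t t'; exists (rin g); first exact: rin_out.
  by move/joinr_transfer: Hg; rewrite -[n]invgK -[n']invgK -En -En'.
Qed.

Lemma sh_atom : sh N X `<=` atom Ap.
Proof. by move=> s [t _ <-]; have := proj2_sig t; rewrite is_atomP. Qed.

Lemma gen_mon_atom (Y : set A) : Y `<=` atom Ap -> forall s, atom Ap s ->
  subm_set (gen_mon Y) s -> Y s.
Proof.
move=> YA s [Us s1 H] /gen_mon_split [//|[y [g [Yy Gg E]]]].
have [Uy y1 _] := YA _ Yy.
have Ug : subm_set Ap g.
  by apply: gen_mon_le Gg; [exact: submP | move=> z /YA []].
by have [//|g1] := H y g Uy Ug (esym E); rewrite E g1 mulg1.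
Qed.

End Nu.

Section LoopParabolic.
Variables (X : ribbon_ob D) (V : submonoid A) (d : A).
Hypotheses (HV : garside V d) (VU : V `<=` Ap)
  (VN : forall g, subm_set V g -> norm X g)
  (Vdv : div_closed Ap V) (Vdvr : div_closed (iv Ap) (iv V))
  (Vj : join_closed Ap V) (Vjr : join_closed (iv Ap) (iv V))
  (Vout : forall g v, out Ap X g -> subm_set V v -> dv Ap g v -> subm_set V g)
  (Voutr : forall g v, out (iv Ap) (iv X) g -> iv V v -> dv (iv Ap) g v -> iv V g)
  (dD : dv Ap d Delta)
  (dmax : forall v, subm_set V v -> dv Ap v Delta -> dv Ap v d).
Let HM := ga_noeth HG.

(* The two sides are treated at once: [(M, Y, W)] is [(Ap, X, V)] or its
   mirror image. *)
Lemma part_odv (M Y W : set A) : noeth M -> has_joins M -> W `<=` M ->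
  is_submonoid W -> (forall g, W g -> out M Y g) -> div_closed M W ->
  join_closed M W -> has_joins W ->
  (forall g v, out M Y g -> W v -> dv M g v -> W g) ->
  forall a b, W a -> W b ->
    (exists2 m, is_join (odv M Y) a b m & W m) /\
    (exists2 m, is_meet (odv M Y) a b m & W m).
Proof.
move=> HM' J WM Ws Wo Wd Wj JW Wout a b Wa Wb; split.
  have [m Hm] := J a b (WM _ Wa) (WM _ Wb); have Wm := Wj _ _ _ Wa Wb Hm.
  have [am [bm H]] := Hm; exists m => //.
  split; first by split=> //; apply: Wo.
  split; first by split=> //; apply: Wo.
  by move=> c [_ Oc ac] [_ _ bc]; split=> //; [exact: Wo | exact: H].
(* The meet is taken in [W]: a ribbon dividing [a] and [b] lies in [W] by [Wout], hence divides
   it. *)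
have [m [ma [mb H]]] := meet_ex (sub_noeth HM' WM Ws) JW Wa Wb.
have Wm : W m by case: ma.
have le x y : dv W x y -> dv M x y by move=> [Wx Wxy]; split; exact: WM.
exists m => //; split; first by split; [exact: Wo | exact: Wo | exact: le].
split; first by split; [exact: Wo | exact: Wo | exact: le].
move=> c [Oc _ ca] [_ _ cb]; have Wc := Wout _ _ Oc Wa ca.
split=> //; first exact: Wo.
by apply: le; apply: H; apply: (dv_sub Wd).
Qed.

Lemma part_rout g : subm_set V g -> out Ap X g.
Proof. by move=> Vg; split; [exact: VU | rewrite VN //; exact: ribbon_ob_closed]. Qed.

Lemma part_rin g : iv V g -> out (iv Ap) (iv X) g.
Proof.
move=> Vg; split; first exact: VU.
rewrite -iv_conj; apply: iv_closed.
by rewrite -[g]invgK (normV (VN Vg)); exact: ribbon_ob_closed.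
Qed.

Lemma loop_parabolic : exists2 Q : parabolic_data (loop_sub Ap X V),
  is_parabolic (ribbon_garside HD) Q & forall x, sval (pdelta Q x) = d.
Proof.
have Vd := ga_mem HV.
pose C := sub_cat (loop_sub Ap X V).
pose mk (x y : ob C) g (Vg : subm_set V g) : @hom C x y :=
  @loop_hom A Ap D X Ap V _ _ g (VU Vg) Vg (VN Vg) (proj2_sig x) (proj2_sig y).
have memV (x y : ob C) (f : @hom C x y) : subm_set V (sval (sval f)).
  by have [] := loop_homE f.
pose act b (Hb : forall g, subm_set V g -> subm_set V (g ^ b)) (x y : ob C)
  (f : @hom C x y) : @hom C x y := mk x y _ (Hb _ (memV x y f)).
have act1 (x : ob C) : act d (ga_conj HV) x x (idm x) = idm x.
  by apply: loop_eq; rewrite /= conj1g.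
have actM (x y z : ob C) (f : @hom C x y) (g : @hom C y z) :
    act d (ga_conj HV) x z (f ∘> g) =
    act d (ga_conj HV) x y f ∘> act d (ga_conj HV) y z g.
  by apply: loop_eq; rewrite /= conjMg.
pose F := @Functor C C id (act d (ga_conj HV)) act1 actM.
pose Q := @ParabolicData (ribbon_cat D Ap) (loop_sub Ap X V) F
  (fun x => sval (mk x x d Vd)).
exists Q => //; split.
- move=> Y YX; have YX' : Y = X := YX; subst Y; split=> f g Pf Pg.
    have Vf : subm_set V (rout f) by case: Pf.
    have Vg : subm_set V (rout g) by case: Pg.
    have PP h : subm_set V (rout h) -> @sub_out _ (loop_sub Ap X V) X h.
      case: h => Y [h [Uh E]] /= Vh; split=> //.
      by apply: ribbon_ob_eq; rewrite -E; exact: VN.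
    have [[m Hm Vm] [n Hn Vn]] := part_odv HM (ga_jl HG) VU (submP V) part_rout
      Vdv Vj (ga_jl HV) Vout Vf Vg.
    split.
      have [h Eh] := rout_ex (part_rout Vm); rewrite -Eh in Hm Vm.
      by exists h; [apply/rjoinl_transfer | exact: PP].
    have [h Eh] := rout_ex (part_rout Vn); rewrite -Eh in Hn Vn.
    by exists h; [apply/rmeetl_transfer | exact: PP].
  have Vf : iv V (rin f) by rewrite /iv /rin /= invgK; case: Pf.
  have Vg : iv V (rin g) by rewrite /iv /rin /= invgK; case: Pg.
  have PP h : iv V (rin h) -> @sub_in _ (loop_sub Ap X V) X h.
    rewrite /iv /rin /= invgK; case: h => Y [h [Uh E]] /= Vh; split=> //.
    by apply: ribbon_ob_eq; rewrite -(normV (VN Vh)) -E conj_set_comp mulgV conj_set1.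
  have [[m Hm Vm] [n Hn Vn]] := part_odv (iv_noeth HM) (ga_jr HG)
    (fun g Ug => VU Ug) (iv_sub (submP V)) part_rin Vdvr Vjr (ga_jr HV) Voutr Vf Vg.
  split.
    have [h Eh] := rin_ex (part_rin Vm); rewrite -Eh in Hm Vm.
    by exists h; [apply/rjoinr_transfer | exact: PP].
  have [h Eh] := rin_ex (part_rin Vn); rewrite -Eh in Hn Vn.
  by exists h; [apply/rmeetr_transfer | exact: PP].
- split; first by exists id.
  move=> x y; exists (act d^-1 (ga_conjV HV) x y) => f; apply: loop_eq => /=.
    by rewrite conjgK.
  by rewrite conjgKV.
- by move=> x y v; apply: sval_eq; rewrite /= -conjgC.
- move=> [Y YX]; have YX' : Y = X := YX; subst Y; move=> delta Dl.
  have dE : rout delta = d by [].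
  have DE : rout Dl = Delta by [].
  have OD : out Ap X Delta by rewrite -DE; exact: rout_out.
  have PP h : @sub_out _ (loop_sub Ap X V) X h <-> subm_set V (rout h).
    split; first by case.
    case: h => Y [h [Uh E]] /= Vh; split=> //.
    by apply: ribbon_ob_eq; rewrite -E; exact: VN.
  have divP f : left_div f delta <-> left_div f Dl /\ @sub_out _ (loop_sub Ap X V) X f.
    rewrite !rout_divP dE DE PP; split.
      move=> [Of Od fd]; split; last exact: Vout fd.
      by split=> //; exact: (dv_trans HM fd dD).
    by move=> [[Of _ fD] Vf]; split=> //; [exact: part_rout | exact: dmax].
  split; apply/seteqP; split=> f /=.
  + by move/divP.
  + by move/divP.
  (* Such an [f] is its own meet with [Delta]. *)
  + move=> /divP [fD Vf]; exists f => //; split=> //; split=> //.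
    apply/rout_divP; split; try exact: rout_out.
    by apply: dv_refl HM _ _; have [] := rout_out f.
  + move=> [p Vp [fD [fp _]]]; apply/divP; split=> //.
    move/PP: Vp => Vp; apply/PP; move/rout_divP: fp => [Of _ fp].
    exact: Vout fp.
Qed.

End LoopParabolic.

End Ribbon.

Theorem theorem4p21 (A : groupType) (Ap : submonoid A)
    (D : garside_data (mon_cat Ap)) (HD : is_garside D)
    (HA : is_formal_inverses (mon_incl (@sub_full A Ap)))
    (N : nu_structure D) (X : ribbon_ob D) (DX Dsh : A)
    (HDX : parabolic_submonoid D X DX)
    (Hsh : sh N X = sht N X)
    (HDsh : parabolic_submonoid D (gen_mon (sh N X)) Dsh) :
  exists GSH : garside_data (mon_cat (gen_mon (SH N X))),
    (* (i) *)
    [/\ is_garside GSH /\ sval (gDelta GSH tt) = Dsh,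
        exists2 Q : parabolic_data (loop_sub Ap X (gen_mon (SH N X))),
          standard_parabolic (ribbon_garside HD)
            (ribbon_incl D (@sub_full A Ap)) Q
            (loop_sub (full A) X (gen_grp (SH N X)))
          & forall x, sval (pdelta Q x) = Dsh,
        is_formal_inverses (mon_incl (@gen_mon_grp A (SH N X))) &
        atoms (gen_mon (SH N X)) = SH N X] /\
    (* (ii) *)
    exists nabla : A,
      [/\ subm_set Ap nabla /\ Dsh = DX * nabla,
          exists2 Q : parabolic_data
              (mon_sub (gen_mon (SH N X)) (gen_mon (SHnu N X))),
            standard_parabolic GSH (mon_incl (@gen_mon_grp A (SH N X))) Q
              (mon_sub (gen_grp (SH N X)) (gen_grp (SHnu N X)))
            & forall x, sval (pdelta Q x) = nabla &
          is_semidirect_product (gen_grp (SH N X))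
            (quasi_centralizer X) (gen_grp (SHnu N X))].
Proof.
pose Delta := sval (gDelta D tt).
have HG : garside Ap Delta := is_garside_garside HD.
have HGi := garside_iv HG; have HM := ga_noeth HG; have HMi := ga_noeth HGi.
have HX : parab Ap Delta X DX by apply: (parabolic_parab HD).
have HXi := parab_iv HG HX.
pose W := gen_mon (sh N X).
have HW : parab Ap Delta W Dsh by apply: (parabolic_parab HD).
have HWi := parab_iv HG HW.
have HR := nu_rel_system HD N X; have HRi := nut_rel_system HD N X.
have Wsh s : atom Ap s -> subm_set W s -> sh N X s.
  by apply: gen_mon_atom; exact: sh_atom.
have XW : X `<=` W.
  move=> x Xx; have Ux := cl_le (pa_closed HX) Xx.
  elim/(atom_ind HM): x / Ux Xx => [|s g As Ug IH Xsg]; first by move=> _; exact: (submP W).1.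
  have [Us _ _] := As; have [Xs Xg] := cl_fc (pa_closed HX) Us Ug Xsg.
  apply: (submP W).2 (IH Xg); apply: gen_mon_mem.
  have [t Et] := atom_type_ex As; exists t => //; split; last by exists t.
  by apply: (nu_norm HG HX HR Xs As); exists t.
have XWi : iv X `<=` iv W by move=> x; apply: XW.
have RW s : atom Ap s -> subm_set W s -> exists2 n, nu_rel N X s n & norm X n.
  move=> As /(Wsh _ As) [t [Nt _] Et]; exists (nu_val N X t) => //.
  by exists t.
(* The right-handed ribbon of an atom of [W] is a loop because [sh] and [sht] agree. *)
have RWi s : atom (iv Ap) s -> iv W s -> exists2 n, nut_rel N X s n & norm (iv X) n.
  move=> /iv_atomV As /(Wsh _ As); rewrite Hsh => -[t [Nt _] Et].
  exists (nut_val N X t)^-1; first by exists t; rewrite ?invgK.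
  by apply/norm_iv/normV.
have SHE : SH N X = shakers X (nu_rel N X) W.
  apply/seteqP; split=> [n [Nn [t Et]]|n [_ [Nn [s [t _ Et]]]]]; last first.
    by split=> //; exists t.
  (* The index of a looping ribbon lies in [sh(X)], hence in [W], so the ribbon itself lies in
     [W]. *)
  have shs : sh N X (sval (sval t)).
    by exists t => //; split; [rewrite Et | exists t].
  have Rn : nu_rel N X (sval (sval t)) n by exists t.
  split; last by split=> //; exists (sval (sval t)).
  by apply: (nu_W HG HX HR HW XW _ _ Rn); [exact: sh_atom shs | exact: gen_mon_mem].
pose V := shaker_part X W.
have VE : V = gen_mon (SH N X) :> set A by rewrite SHE; exact: (part_gen HG HX HR HW XW RW).
have iVE : shaker_part (iv X) (iv W) = iv V by exact: iv_shaker_part.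
have VU : V `<=` Ap := part_le HW.
have Vs : is_submonoid V := part_sub HG HX HR HW XW RW.
have Vdiv : div_closed Ap V := part_div HW.
have Vj : join_closed Ap V := part_join HG HX HR HW XW RW.
have Vdivr : div_closed (iv Ap) (iv V) by rewrite -iVE; exact: (part_div HWi).
have Vjr : join_closed (iv Ap) (iv V).
  by rewrite -iVE; exact: (part_join HGi HXi HRi HWi XWi RWi).
have VN g : V g -> norm X g by case.
have VDsh : V Dsh := garside_part HG HX HR HW XW RW.
have Vat s : atom V s <-> SH N X s by rewrite SHE; exact: (part_atom HG HX HR HW XW RW s).
have HV : normalizing_part Ap X V.
  split=> //; [exact: ga_jl HG | exact: pa_closed HX |].
  by move=> g x; exact: (part_reduce HG HX HR HW XW).
have HVi : normalizing_part (iv Ap) (iv X) (iv V).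
  split=> //.
  - exact: ga_jr HG.
  - exact: pa_closed HXi.
  - by move=> g; apply: VU.
  - exact: iv_sub.
  - by move=> g /VN /normV; rewrite invgK => /norm_iv.
  - by rewrite -iVE => g x; exact: (part_reduce HGi HXi HRi HWi XWi).
have HVG : garside V Dsh.
  split=> //.
  - exact: (sub_noeth HM VU Vs).
  - move=> g [Wg Ng]; split; first by have [] := parab_conj HG HW Wg.
    by rewrite conjgE; apply: normM; [exact: normV (VN _ VDsh) | apply: normM => //; exact: VN].
  - move=> g [Wg Ng]; split; first by have [] := parab_conj HG HW Wg.
    rewrite conjgE invgK; apply: normM; first exact: VN.
    by apply: normM => //; apply: normV; exact: VN.
  - exact: (sub_has_joins HM VU Vs Vdiv (ga_jl HG) Vj).
  - apply: (sub_has_joins HMi _ (iv_sub Vs) Vdivr (ga_jr HG) Vjr).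
    by move=> g; apply: VU.
  - by move=> s /Vat; rewrite SHE; exact: (shaker_dv HG HX HR HW XW RW).
pose T := SH N X; pose G := gen_mon T.
have VG : V = G :> set A := VE.
have HGG : garside G Dsh by rewrite -VG.
have [GSH HGSH GSHE] := garside_is_garside HGG.
have Gsub := gen_grp_subgroup T.
have Gore : ore_monoid G by apply: joins_ore; exact: ga_jl HGG.
have Gfrac : fractions_of G (gen_grp T).
  by move=> g; apply: gen_grp_frac Gore _ => //; [exact: submP | exact: gen_mon_mem].
exists GSH; split.
  split.
  - by split.
  - have [Q HQ QE] : exists2 Q : parabolic_data (loop_sub Ap X G),
        is_parabolic (ribbon_garside HD) Q & forall x, sval (pdelta Q x) = Dsh.
      apply: loop_parabolic => //; rewrite -?VG //.
      (* [W] is closed under factors, so a ribbon dividing an element of [V] lies in [W] and is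
         therefore a loop. *)
      + move=> g v Og Vv gv; apply: (out_part HG HX HR HW XW RW) => //.
        by have [] := fc_dv (cl_le (pa_closed HW)) (cl_fc (pa_closed HW)) Vv.1 gv.
      + rewrite -iVE => g v Og [Wv _] gv; apply: (out_part HGi HXi HRi HWi XWi RWi) => //.
        by have [] := fc_dv (cl_le (pa_closed HWi)) (cl_fc (pa_closed HWi)) Wv gv.
      + exact: pa_dv HW.
      + by move=> v [Wv _]; exact: (pa_max HW).
    exists Q => //; split=> //.
    apply: loop_formal => //.
    - by rewrite -VE.
    - exact: gen_mon_grp.
    - exact: (norm_gen_grp HV VE).
  - exact: mon_incl_formal.
  - by rewrite atomsE; apply/seteqP; split=> s; rewrite -VG => /Vat.
pose U := reduced_part Ap X V.
have UE : U = gen_mon (SHnu N X) :> set A.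
  by apply: reduced_gen HV _ VE _ => n /Vat.
have VDX : V DX.
  by split; [exact: XW (pa_mem HX) | exact: (norm_garside HG HX)].
have DXsh : dv Ap DX Dsh.
  apply: (pa_max HW); first exact: XW (pa_mem HX).
  exact: pa_dv HX.
have HU : parab V Dsh U (DX^-1 * Dsh).
  apply: (reduced_part_parab HV HVi) => //; first exact: pa_mem HX.
  move=> x Xx xs; apply: (pa_max HX) => //; exact: (dv_trans HM xs (pa_dv HW)).
have HXG : garside X DX := parab_garside HG HX.
have JU : has_joins U := ga_jl (parab_garside HVG HU).
exists (DX^-1 * Dsh); split.
- by split; [exact: DXsh.2 | rewrite mulVKg].
- have HU' : parab G (sval (gDelta GSH tt)) (gen_mon (SHnu N X)) (DX^-1 * Dsh).
    by rewrite GSHE -VG -UE.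
  have [Q HQ QE] := parab_parabolic HGSH HU'.
  exists Q => //; split=> //.
  apply: mon_sub_formal.
  - by rewrite -VG -UE => g [].
  - exact: gen_mon_grp.
  - by apply: gen_grp_le => // n [Tn _]; exact: gen_grp_mem.
  - exact: gen_grp_subgroup.
  - move=> g; apply: gen_grp_frac.
    + exact: submP.
    + exact: gen_mon_mem.
    + by apply: joins_ore; rewrite -UE.
  - by apply: joins_ore; rewrite -UE.
- apply: (semidirect_part HV HXG VDX _ VE UE JU).
  by move=> g Xg Ng; split=> //; exact: XW.
Qed.
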